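(* For each integer $g\ge 1$ and each integer $N$, there exists a connected simple graph with $n\ge N$ vertices and $m=2n+g-4$ edges that can be thrackled on $N_g$.
   Context: All graphs are simple. $N_g$ denotes the compact connected nonorientable surface of genus $g$ (so $N_1$ is the projective plane, $N_2$ the Klein bottle). A drawing of a graph on a surface places vertices at distinct points and represents each edge by a simple arc joining its endpoints and containing no other vertex. A thrackle is a drawing such that (i) adjacent edges intersect only at their common vertex, and (ii) any two nonadjacent edges intersect in exactly one point, at which they cross. A graph can be thrackled on a surface if it has a thrackle on that surface. *)

(* Defs.v *)
From HB Require Import structures.
From Stdlib Require Import Relations.
From mathcomp Require Import all_boot all_order all_algebra.
From mathcomp Require Import generic_quotient.
From mathcomp Require Import all_classical all_reals all_analysis.

Set Implicit Arguments.
Unset Strict Implicit.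
Unset Printing Implicit Defensive.

Import Order.TTheory GRing.Theory Num.Theory.
Import numFieldNormedType.Exports.

Local Open Scope classical_set_scope.
Local Open Scope quotient_scope.
Local Open Scope ring_scope.

(* N_g is taken in its standard polygonal normal form: the closed unit disc,
   seen as a 2g-gon whose sides are equal arcs of the unit circle, with sides
   identified according to the word a_1 a_1 a_2 a_2 ... a_g a_g. *)
Section NonorientableSurface.
Variables (R : realType) (g : nat).

Definition unit_disc : set (R * R) := [set z | z.1 ^+ 2 + z.2 ^+ 2 <= 1].

(* The k-th side of the 2g-gon (0 <= k < 2g) is the image of [k, k + 1]. *)
Definition boundary (t : R) : R * R :=
  (cos (pi * t / g%:R), sin (pi * t / g%:R)).

(* Sides 2i and 2i + 1 both carry the letter a_(i+1), with the same
   orientation. *)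
Definition side_pairing (z w : unit_disc) : Prop :=
  exists (i : nat) (t : R),
    [/\ (i < g)%N, 2 * i%:R <= t <= 2 * i%:R + 1,
        val z = boundary t & val w = boundary (t + 1)].

Definition glued (z w : unit_disc) : bool :=
  `[< clos_refl_sym_trans _ side_pairing z w >].

Fact glued_refl : reflexive glued.
Proof. by move=> z; apply/asboolP; exact: rst_refl. Qed.

Fact glued_sym : symmetric glued.
Proof. by move=> z w; apply/asboolP/asboolP; exact: rst_sym. Qed.

Fact glued_trans : transitive glued.
Proof.
move=> w z u /asboolP zw /asboolP wu; apply/asboolP.
exact: rst_trans zw wu.
Qed.

Canonical glued_equiv := EquivRel glued glued_refl glued_sym glued_trans.

Definition nonorientable_surface : topologicalType :=
  quotient_topology {eq_quot glued}.

End NonorientableSurface.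

(* Topological crossing of two arcs A and B at p: some open embedding psi of a
   neighbourhood W of the origin of the plane, with psi 0 = p, takes the two
   coordinate axes to A and B. *)
Definition crosses_at (R : realType) (S : topologicalType) (A B : set S)
    (p : S) : Prop :=
  exists (W : set (R * R)) (psi : R * R -> S),
    [/\ open W /\ W (0, 0),
        psi (0, 0) = p,
        (forall z, W z -> {for z, continuous psi}) /\ set_inj W psi,
        forall O, open O -> O `<=` W -> open (psi @` O) &
        forall z, W z -> (A (psi z) <-> z.2 = 0) /\ (B (psi z) <-> z.1 = 0)].

Section Thrackles.
Variables (V : finType) (e : rel V).

Definition simple_graph : Prop := symmetric e /\ irreflexive e.

Definition connected_graph : Prop :=
  (0 < #|V|)%N /\ forall x y : V, connect e x y.

Definition edges : {set {set V}} :=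
  [set E : {set V} | [exists x, exists y, e x y && (E == [set x; y])]]%SET.

Variables (R : realType) (S : topologicalType).
Variables (pos : V -> S) (arc : {set V} -> R -> S).

Definition trace (E : {set V}) : set S := arc E @` `[0, 1].

(* [arc E] is only relevant for E \in edges, and on [0, 1]. *)
Definition is_drawing : Prop :=
  injective pos /\
  forall E : {set V}, E \in edges ->
    [/\ {within `[0, 1], continuous (arc E)},
        set_inj `[0, 1] (arc E),
        exists x y : V, [/\ E = [set x; y]%SET, arc E 0 = pos x
                          & arc E 1 = pos y] &
        forall v : V, trace E (pos v) -> v \in E].

Definition is_thrackle : Prop :=
  [/\ is_drawing,
      forall (E F : {set V}) (v : V), E \in edges -> F \in edges ->
        (E :&: F = [set v])%SET -> trace E `&` trace F = [set pos v] &
      forall E F : {set V}, E \in edges -> F \in edges -> E :&: F = finset.set0 ->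
        exists2 p : S, trace E `&` trace F = [set p]
                     & crosses_at R (trace E) (trace F) p].

End Thrackles.

Definition can_be_thrackled (R : realType) (V : finType) (e : rel V)
    (S : topologicalType) : Prop :=
  exists (pos : V -> S) (arc : {set V} -> R -> S), is_thrackle e pos arc.

(* Main.v *)
(* The genus g surface is the closed disc with its boundary divided into 2g
   sides glued in consecutive pairs, so an arc can be drawn as a chain of
   straight chords, each chord starting at the boundary point glued to the end
   of the previous one; the corners of the polygon form a single point.  Two
   chords meet exactly when their endpoints interlace, so that checking a
   thrackle amounts to checking cyclic orders of boundary points.

   The graph is a fan (an apex joined to all vertices of a path x_1 ... x_V)
   together with edges x_1 x_3 and x_(V-2k) x_(V-2k+2), 1 <= k <= K.  The apex
   is the corner point.  One crosscap carries the zigzag drawing of the fan;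
   this settles g = 1.  Otherwise g = K + 2: a second crosscap lets x_1 x_3 be
   added, and each further edge uses one more crosscap, a gate placed at the
   corner, whose purpose is to let that edge cross the one spoke that it would
   miss.  The edge of number k winds through the gates 1, ..., k and back,
   and the spoke of x_2 goes straight through all gates. *)

From Stdlib Require Import Relations.
From mathcomp Require Import all_boot all_order all_algebra.
From mathcomp Require Import generic_quotient.
From mathcomp Require Import all_classical all_reals all_analysis.
From mathcomp Require Import ring lra zify.
Require Import Defs.

Set Implicit Arguments.
Unset Strict Implicit.
Unset Printing Implicit Defensive.

Import Order.TTheory GRing.Theory Num.Theory.
Import numFieldNormedType.Exports.

Local Open Scope classical_set_scope.
Local Open Scope quotient_scope.
Local Open Scope ring_scope.

(** Everything rests on depth. The spoke of x_l starts with a chord joining two boundary points of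
    depth l, and these chords are nested (x_1 and x_2 deviate from this if g > 1). An edge x_j x_i
    with i < j that leaves x_j inward and comes back to x_i from outside crosses the spokes l > j
    and l < i: all nonadjacent ones if j = i + 1, but if j = i + 2 it misses the spoke of x_(i+1).
    Since every corner of the polygon is the apex, that spoke may end at any corner; it is sent to
    one inside gate k, which edge k cuts off where it turns back.

    The obstacle is that edge k must meet nothing else in the gates, in particular not the spoke of
    x_2. A crosscap reverses the order of the strands through it, and chords around the corner
    between two gates are disjoint only if they are nested. So a strand changes sides of the spoke
    of x_2 from one gate to the next, and it can turn only after an even number of passages: edge k
    turns beyond gate k if k is even, before it if k is odd. *)

Section Plane.

(** * Affine geometry of the plane *)

Variable R : realType.
Implicit Types a b c d z : R * R.

Definition sqn z : R := z.1 ^+ 2 + z.2 ^+ 2.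

Definition orient a b c : R :=
  (b.1 - a.1) * (c.2 - a.2) - (b.2 - a.2) * (c.1 - a.1).

Definition point_on a b (s : R) : R * R :=
  (a.1 + s * (b.1 - a.1), a.2 + s * (b.2 - a.2)).

Lemma point_on0 a b : point_on a b 0 = a.
Proof. by case: a => a1 a2; rewrite /point_on !mul0r !addr0. Qed.

Lemma point_on1 a b : point_on a b 1 = b.
Proof. by case: b => b1 b2; rewrite /point_on !mul1r !subrKC. Qed.

(** The power of a point on a chord is the product of the two pieces, whence the factor
    [s * (1 - s)]. *)
Lemma sqn_point_on a b s : sqn a = 1 -> sqn b = 1 ->
  sqn (point_on a b s) = 1 - s * (1 - s) * sqn (b - a).
Proof.
rewrite /sqn /= => ha hb.
have -> : 1 - s * (1 - s) * ((b.1 - a.1) ^+ 2 + (b.2 - a.2) ^+ 2) =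
  1 - s * (1 - s) * ((b.1 ^+ 2 + b.2 ^+ 2) + (a.1 ^+ 2 + a.2 ^+ 2) - 2 * (a.1
    * b.1 + a.2 * b.2)) by ring.
have -> : (a.1 + s * (b.1 - a.1)) ^+ 2 + (a.2 + s * (b.2 - a.2)) ^+ 2 =
  (1 - s) ^+ 2 * (a.1 ^+ 2 + a.2 ^+ 2) + s ^+ 2 * (b.1 ^+ 2 + b.2 ^+ 2) + 2 *
    s * (1 - s) * (a.1 * b.1 + a.2 * b.2) by ring.
rewrite ha hb; ring.
Qed.

Lemma sqn_gt0 z : z != 0 -> 0 < sqn z.
Proof.
case: z => x y; rewrite /sqn /= xpair_eqE negb_and => h.
rewrite lt_neqAle addr_ge0 ?sqr_ge0// andbT eq_sym.
by rewrite paddr_eq0 ?sqr_ge0// !sqrf_eq0 negb_and.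
Qed.

Lemma point_on_inj a b : a != b -> injective (point_on a b).
Proof.
move=> ab s t [/addrI h1 /addrI h2].
have : (b.1 - a.1 != 0) || (b.2 - a.2 != 0).
  rewrite !subr_eq0 -negb_and; apply: contra ab => /andP[/eqP h /eqP h'].
  by rewrite (surjective_pairing a) (surjective_pairing b) h h'.
by case/orP => hn; [apply: (mulIf hn h1)|apply: (mulIf hn h2)].
Qed.

Lemma orient_point_on a b c d s :
  orient a b (point_on c d s) = (1 - s) * orient a b c + s * orient a b d.
Proof. rewrite /orient /=; ring. Qed.

Lemma orient_aab a b : orient a b a = 0. Proof. rewrite /orient; ring. Qed.
Lemma orient_abb a b : orient a b b = 0. Proof. rewrite /orient; ring. Qed.
Lemma orientNl a b c : orient b a c = - orient a b c.
Proof. rewrite /orient; ring. Qed.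
Lemma orient_cyc a b c : orient b c a = orient a b c.
Proof. rewrite /orient; ring. Qed.
Lemma orient_point_on_self a b s : orient a b (point_on a b s) = 0.
Proof. by rewrite orient_point_on orient_aab orient_abb !mulr0 addr0. Qed.

(** The orientation is affine along the line through [c] and [d] and takes opposite signs at these
    points, so it has a single zero. This makes crossings unique. *)
Lemma orient_point_on_inj a b c d s t : orient a b c * orient a b d < 0 ->
  orient a b (point_on c d s) = 0 -> orient a b (point_on c d t) = 0 -> s = t.
Proof.
rewrite !orient_point_on; move: (orient a b c) (orient a b d) => x y xy h1 h2.
have xy0 : x - y != 0 by apply/eqP => h; nra.
have : (s - t) * (x - y) = 0.
  have -> : (s - t) * (x - y) = ((1 - t) * x + t * y) - ((1 - s) * x + s * y)
    by ring.
  by rewrite h1 h2 subrr.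
by move/eqP; rewrite mulf_eq0 (negbTE xy0) orbF subr_eq0 => /eqP.
Qed.

(** An affine function with value x at 0 and y at 1 vanishes at x / (x - y), which lies between 0
    and 1 when the signs are opposite; both parameters are found in this way. *)
Lemma point_on_cross a b c d :
  orient a b c * orient a b d < 0 -> orient c d a * orient c d b < 0 ->
  exists s t, [/\ 0 < s < 1, 0 < t < 1 & point_on a b s = point_on c d t].
Proof.
have aux (x y : R) : x * y < 0 -> [/\ x - y != 0 & 0 < x / (x - y) < 1].
  move=> xy; have /orP[/andP[x0 y0]|/andP[x0 y0]] : ((0 < x) && (y < 0)) ||
    ((x < 0) && (0 < y)).
    by case: (ltrgt0P x) xy => [x0|x0|->]; rewrite ?mul0r ?ltxx// => xy;
      apply/orP; [left|right]; nra.
  - have xy0 : 0 < x - y by lra.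
    split; first by rewrite gt_eqF.
    by rewrite divr_gt0// ltr_pdivrMr// mul1r; lra.
  - have xy0 : 0 < y - x by lra.
    split; first by rewrite subr_eq0 lt_eqF// (lt_trans x0).
    by rewrite -opprB invrN mulrN -mulNr divr_gt0 ?oppr_gt0// ltr_pdivrMr//
      mul1r; lra.
move=> /aux[n1 h1] /aux[n2 h2].
exists (orient c d a / (orient c d a - orient c d b)).
exists (orient a b c / (orient a b c - orient a b d)); split=> //.
move: n1 n2; rewrite /orient /point_on /= => n1 n2.
by congr pair; field; rewrite n1 n2.
Qed.

End Plane.

(** * Chords of a circle *)

Section Interlacing.
Variables (T : Type) (lt : rel T).

(** Stated for any relation, because the test is moved from real parameters to pairs of a side and
    an offset. *)
Definition alternate (a b c d : T) : bool :=
  [&& lt a c, lt c b & lt b d] || [&& lt c a, lt a d & lt d b].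

Definition interlaced (a b c d : T) : bool :=
  [|| alternate a b c d, alternate b a c d, alternate a b d c
    | alternate b a d c].

End Interlacing.

Section Circle.
Variables (R : realType) (g : nat).
Hypothesis g_gt0 : (0 < g)%N.
Notation B := (@boundary R g).
Let G : R := 2 * g%:R.

Let g_neq0 : (g%:R : R) != 0. Proof. by rewrite pnatr_eq0 -lt0n. Qed.
Let G_gt0 : 0 < G. Proof. by rewrite mulr_gt0// ltr0n. Qed.

(** Half the angle of [boundary t]: parameters less than one turn apart differ by an amount in ]0,
    pi[, where the sine is positive. *)
Let th (t : R) := pi * t / G.
Let BE t : B t = (cos (th t *+ 2), sin (th t *+ 2)).
Proof. by rewrite /boundary /th /G; congr (cos _, sin _); field. Qed.

Let thB a b : th (a - b) = th a - th b. Proof. by rewrite /th; ring. Qed.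

Let sin_th t : 0 < t < G -> 0 < sin (th t).
Proof.
move=> /andP[t0 tG]; apply: sin_gt0_pi; rewrite /th.
have pi0 := pi_gt0 R.
apply/andP; split; first by rewrite divr_gt0// mulr_gt0.
by rewrite ltr_pdivrMr// ltr_pM2l.
Qed.

Lemma sqn_boundary t : sqn (B t) = 1.
Proof. exact: cos2Dsin2. Qed.

(** Twice the area of an inscribed triangle, as four times the product of the sines of its angles;
    its sign then depends only on the cyclic order. *)
Lemma orient_boundary a b c : orient (B a) (B b) (B c) =
  4 * sin (th (b - a)) * sin (th (c - b)) * sin (th (c - a)).
Proof.
set p := th (b - a); set q := th (c - b).
have -> : th (c - a) = p + q by rewrite /p /q /th; ring.
have -> : orient (B a) (B b) (B c) =
    sin (q *+ 2) - sin (p *+ 2 + q *+ 2) + sin (p *+ 2).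
  have -> : p *+ 2 + q *+ 2 = th c *+ 2 - th a *+ 2 by rewrite /p /q !thB; ring.
  have -> : p *+ 2 = th b *+ 2 - th a *+ 2 by rewrite /p !thB; ring.
  have -> : q *+ 2 = th c *+ 2 - th b *+ 2 by rewrite /q !thB; ring.
  by rewrite !BE /orient /= !sinB; ring.
have s2 x : sin (x *+ 2) = 2 * sin x * cos x :> R by rewrite mulr2n sinD; ring.
rewrite [sin (_ + q *+ 2)]sinD !s2 !cos_mulr2n sinD.
have -> : cos p ^+ 2 = 1 - sin p ^+ 2 by rewrite -(cos2Dsin2 p); ring.
have -> : cos q ^+ 2 = 1 - sin q ^+ 2 by rewrite -(cos2Dsin2 q); ring.
ring.
Qed.

Lemma boundary_inj a b : `|a - b| < G -> B a = B b -> a = b.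
Proof.
have aux x y : x < y -> y - x < G -> B x <> B y.
  move=> xy xyG; rewrite !BE => -[hc hs].
  have : cos (th (y - x) *+ 2) = 1.
    have -> : th (y - x) *+ 2 = th y *+ 2 - th x *+ 2 by rewrite thB; ring.
    by rewrite cosB hc hs -!expr2 cos2Dsin2.
  have := cos2Dsin2 (th (y - x)); rewrite cos_mulr2n => h1 h2.
  have : 0 < sin (th (y - x)) by apply: sin_th; lra.
  move=> /exprn_gt0 -/(_ 2); lra.
rewrite ltr_norml => /andP[h1 h2] h.
case: (ltrgtP a b) => // ab; exfalso.
  by apply: (aux _ _ ab) => //; lra.
by apply: (aux _ _ ab) => //; lra.
Qed.

Lemma orient_boundary_gt0 a b c : a < b -> b < c -> c < a + G ->
  0 < orient (B a) (B b) (B c).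
Proof.
move=> ab bc ca; rewrite orient_boundary.
by rewrite !mulr_gt0// sin_th//; lra.
Qed.

Implicit Types a b c d s t : R.

Let dom t := 0 <= t < G.

(** The equality case is recorded because chords may share an endpoint. *)
Lemma orient_boundary_inside a b c : dom a -> dom b -> a <= c <= b ->
  orient (B a) (B b) (B c) <= 0 ?= iff ((c == a) || (c == b)).
Proof.
move=> /andP[a0 aG] /andP[b0 bG] /andP[]; rewrite le_eqVlt => /predU1P[<- _|ac].
  by rewrite orient_aab eqxx; exact/leif_refl.
rewrite le_eqVlt => /predU1P[->|cb]; first by rewrite orient_abb eqxx orbT;
  exact/leif_refl.
rewrite gt_eqF// lt_eqF//=.
suff h : orient (B a) (B b) (B c) < 0 by split; [exact: ltW|exact: lt_eqF].
by rewrite -orient_cyc -[orient _ _ _]opprK -orientNl orient_cyc oppr_lt0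
  orient_boundary_gt0//; lra.
Qed.

Lemma orient_boundary_outside a b c : dom a -> dom b -> dom c -> a < b ->
  (c <= a) || (b <= c) ->
  0 <= orient (B a) (B b) (B c) ?= iff ((c == a) || (c == b)).
Proof.
move=> /andP[a0 aG] /andP[b0 bG] /andP[c0 cG] ab.
case: (eqVneq c a) => [-> _|ca]; first by rewrite orient_aab; exact/leif_refl.
case: (eqVneq c b) => [-> _|cb h]; first by rewrite orient_abb; exact/leif_refl.
suff k : 0 < orient (B a) (B b) (B c) by split; [exact: ltW|exact: lt_eqF].
rewrite !le_eqVlt (negbTE ca) eq_sym (negbTE cb) /= in h.
case/orP: h => h; last by rewrite orient_boundary_gt0//; lra.
by rewrite -orient_cyc -orient_cyc orient_boundary_gt0//; lra.
Qed.

Lemma point_onC (a b : R * R) s : point_on a b s = point_on b a (1 - s).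
Proof. by rewrite /point_on; congr pair; ring. Qed.

Lemma chords_cross a b c d : dom a -> dom b -> dom c -> dom d ->
  interlaced <%R a b c d ->
  [/\ orient (B a) (B b) (B c) * orient (B a) (B b) (B d) < 0
    & orient (B c) (B d) (B a) * orient (B c) (B d) (B b) < 0].
Proof.
(* The signs for one of the eight interlaced orders; the others follow by exchanging the chords or
   reversing them. *)
have H x y z w : dom x -> dom y -> dom z -> dom w -> x < z -> z < y -> y < w ->
    [/\ orient (B x) (B y) (B z) < 0, 0 < orient (B x) (B y) (B w),
      0 < orient (B z) (B w) (B x) & orient (B z) (B w) (B y) < 0].
  move=> /andP[x0 xG] /andP[y0 yG] /andP[z0 zG] /andP[w0 wG] xz zy yw; split.
  - by rewrite -orient_cyc -[orient _ _ _]opprK -orientNl orient_cyc oppr_lt0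
      orient_boundary_gt0//; lra.
  - by rewrite orient_boundary_gt0//; lra.
  - by rewrite -orient_cyc -orient_cyc -orient_cyc orient_cyc
      orient_boundary_gt0//; lra.
  - by rewrite -orient_cyc -[orient _ _ _]opprK -orientNl orient_cyc oppr_lt0
      orient_boundary_gt0//; lra.
have neg x y : x < 0 -> 0 < y -> x * y < 0 :> R by move=> ? ?;
  rewrite nmulr_rlt0.
move=> da db dc dd; rewrite /interlaced /alternate.
by case/or4P => /orP[] /and3P[h1 h2 h3];
  [have [] := H a b c d | have [] := H c d a b
  |have [] := H b a c d | have [] := H c d b a
  |have [] := H a b d c | have [] := H d c a b
  |have [] := H b a d c | have [] := H d c b a] => //;
  rewrite ?[orient (B b) (B a) _]orientNl ?[orient (B d) (B c) _]orientNl
    ?oppr_lt0 ?oppr_gt0 => k1 k2 k3 k4; split;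
      by [exact: neg|rewrite mulrC neg].
Qed.

(** Without interlacing, [c] and [d] lie weakly on one side of the line through [a] and [b], and not
    both on it; so an inner point of the chord [c d] is off the whole line, whatever [s] is. *)
Lemma chords_disjoint a b c d s t : dom a -> dom b -> dom c -> dom d ->
  a != b -> c != d -> ~~ interlaced <%R a b c d ->
  ~~ ((a == c) && (b == d)) -> ~~ ((a == d) && (b == c)) ->
  0 < t < 1 -> point_on (B a) (B b) s <> point_on (B c) (B d) t.
Proof.
wlog ab : a b s / a < b.
  move=> H da db dc dd ab cd nI n1 n2 ht.
  have [lab|lba|eab] := ltgtP a b; [exact: H| |by rewrite eab eqxx in ab].
  rewrite point_onC; apply: H => //.
  - by rewrite eq_sym.
  - by move: nI; apply: contra; rewrite /interlaced; case/or4P => ->;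
      rewrite ?orbT.
  - by move: n2; rewrite andbC.
  - by move: n1; rewrite andbC.
wlog cd : c d t / c < d.
  move=> H da db dc dd ab' cd nI n1 n2 ht.
  have [lcd|ldc|ecd] := ltgtP c d; [exact: H| |by rewrite ecd eqxx in cd].
  rewrite [point_on (B c) _ _]point_onC; apply: H => //.
  - by rewrite eq_sym.
  - by move: nI; apply: contra; rewrite /interlaced; case/or4P => ->;
      rewrite ?orbT.
  - by move: ht; lra.
move=> da db dc dd _ _ nI n1 n2 /andP[t0 t1] E.
have : orient (B a) (B b) (point_on (B c) (B d) t) = 0.
  by rewrite -E orient_point_on_self.
rewrite orient_point_on => E0.
have nI1 : ~~ [&& a < c, c < b & b < d].
  by apply: contra nI; rewrite /interlaced /alternate => ->.
have nI2 : ~~ [&& c < a, a < d & d < b].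
  by apply: contra nI; rewrite /interlaced /alternate => ->; rewrite orbT.
have [c_in|c_out] := boolP (a <= c <= b).
  have [d_in|d_out] := boolP (a <= d <= b).
    have [c1 c2] := orient_boundary_inside da db c_in.
    have [d1 d2] := orient_boundary_inside da db d_in.
    have c0 : orient (B a) (B b) (B c) = 0 by nra.
    have d0 : orient (B a) (B b) (B d) = 0 by nra.
    move: c2 d2; rewrite c0 d0 eqxx => /esym/orP hc /esym/orP hd.
    by case: hc n1 n2 cd ab => /eqP ->; case: hd => /eqP ->;
      rewrite ?eqxx ?ltxx //=; lra.
  have hd : b < d by move: d_out; rewrite negb_and -!ltNge => /orP[|//];
    move: c_in; lra.
  have hc : (c == a) || (c == b).
    move: c_in nI1; rewrite !le_eqVlt hd andbT => /andP[/predU1P[->|->]];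
      first by rewrite eqxx.
    by move=> /predU1P[->|-> //]; rewrite eqxx orbT.
  have [d1 d2] := @orient_boundary_outside a b d da db dd ab ltac:(by rewrite
    (ltW hd) orbT).
  have c0 : orient (B a) (B b) (B c) = 0 by case/orP: hc => /eqP ->;
    rewrite ?orient_aab ?orient_abb.
  have d0 : orient (B a) (B b) (B d) = 0 by nra.
  by move: d2; rewrite d0 eqxx => /esym/orP[]/eqP; lra.
have c_out' : (c <= a) || (b <= c).
  by move: c_out; rewrite negb_and -!ltNge => /orP[]/ltW ->; rewrite ?orbT.
have d_out' : (d <= a) || (b <= d).
  move: c_out nI2; rewrite negb_and -!ltNge => /orP[->|bc] /=;
    last by move=> _; rewrite (ltW (lt_trans bc cd)) orbT.
  by rewrite negb_and -!leNgt.
have [c1 c2] := orient_boundary_outside da db dc ab c_out'.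
have [d1 d2] := orient_boundary_outside da db dd ab d_out'.
have c0 : orient (B a) (B b) (B c) = 0 by nra.
move: c2 c_out; rewrite c0 eqxx => /esym/orP[]/eqP->; rewrite !lexx ?andbT /=;
  rewrite -?ltNge; lra.
Qed.

End Circle.

(** * The polygonal model *)

Section Surface.
Variables (R : realType) (g : nat).
Hypothesis g_gt0 : (0 < g)%N.
Notation S := (nonorientable_surface R g).
Notation B := (@boundary R g).

Let radius (z : R * R) : R := Num.sqrt (Num.max 1 (sqn z)).

Let radius_ge1 z : 1 <= radius z.
Proof. by rewrite -[leLHS]sqrtr1 ler_wsqrtr// le_max lexx. Qed.

Let retract (z : R * R) : R * R := (z.1 / radius z, z.2 / radius z).

Let retract_disc z : retract z \in @unit_disc R.
Proof.
have r0 : 0 < radius z ^+ 2 by rewrite exprn_gt0// (lt_le_trans _ (radius_ge1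
  z)).
apply/mem_set; rewrite /unit_disc /= !expr_div_n -mulrDl ler_pdivrMr// mul1r.
by rewrite sqr_sqrtr ?le_max ?ler01// lexx orbT.
Qed.

Let retract_id z : sqn z <= 1 -> retract z = z.
Proof.
move=> z1; rewrite /retract /radius max_l// sqrtr1 !divr1.
by case: z {z1}.
Qed.

Let to_disc (z : R * R) : @unit_disc R := exist _ (retract z) (retract_disc z).

(* The quotient map, precomposed with the radial retraction of the plane onto
   the disc. *)
Definition proj (z : R * R) : S := \pi_S (to_disc z).

Lemma continuous_sqn : continuous (@sqn R).
Proof.
move=> z; rewrite /sqn.
by apply: cvgD; apply: (@cvg_comp _ _ _ _ (fun x : R => x ^+ 2));
  [exact: cvg_fst|exact: exprn_continuous|exact: cvg_snd|exact:
    exprn_continuous].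
Qed.

Lemma continuous_proj : continuous proj.
Proof.
move=> z; apply: (@continuous_comp _ _ S to_disc (\pi_S));
  last exact: pi_continuous.
move: z; apply: continuous_comp_initial => z /=.
have cr : {for z, continuous radius}.
  apply: continuous_comp; last exact: sqrt_continuous.
  by apply: continuous_max; [exact: cvg_cst|exact: continuous_sqn].
have r0 : radius z != 0 by rewrite gt_eqF// (lt_le_trans _ (radius_ge1 z)).
apply: (@cvg_pair (R * R)%type R R (nbhs z) (nbhs (z.1 / radius z)) (nbhs (z.2
  / radius z)) _ _ _ (fun z => z.1 / radius z) (fun z => z.2 / radius z)).
- by apply: cvgM; [exact: cvg_fst|exact: cvgV].
- by apply: cvgM; [exact: cvg_snd|exact: cvgV].
Qed.

Let val_to_disc z : sqn z <= 1 -> val (to_disc z) = z.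
Proof. exact: retract_id. Qed.

Let to_disc_val (z : @unit_disc R) : to_disc (val z) = z.
Proof. by apply: val_inj; rewrite val_to_disc//; have := set_mem (valP z). Qed.

Let proj_eq z w : proj z = proj w <->
  clos_refl_sym_trans _ (@side_pairing R g) (to_disc z) (to_disc w).
Proof.
split=> [/eqquotP/asboolP//|h].
by apply/eqquotP/asboolP.
Qed.

(** A pairing step relates points of the circle only, so glued points are equal or both on the
    circle. *)
Lemma proj_inj_interior z w : sqn z < 1 -> sqn w <= 1 -> proj z = proj w ->
  z = w.
Proof.
move=> z1 w1 /proj_eq zw.
have : to_disc z = to_disc w \/
    sqn (val (to_disc z)) = 1 /\ sqn (val (to_disc w)) = 1.
  elim: zw => [u v [i [t [_ _ -> ->]]]|u|u v _ [->|[]]|u v x _ [->|[-> ?]] _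
    [<-|[? ->]]];
    by [left|right; rewrite ?sqn_boundary].
have z1' := ltW z1.
case=> [/(congr1 val)|[]]; rewrite !val_to_disc// => e _.
by rewrite e ltxx in z1.
Qed.

(** Interior points are alone in their classes, so such a [U] is its own preimage under the quotient
    map. *)
Lemma open_proj (U : set (R * R)) : open U -> U `<=` [set z | sqn z < 1] ->
  open (proj @` U).
Proof.
move=> oU U1; rewrite /open /= /quotient_open.
rewrite (_ : _ @^-1` _ = (val : @unit_disc R -> R * R) @^-1` U).
  by exists U.
apply/seteqP; split=> [z [w Uw]|z Uz] /=; last by exists (val z) => //;
  rewrite /proj to_disc_val.
rewrite -[z in \pi z]to_disc_val => /(proj_inj_interior (U1 _ Uw)) <- //.
exact: set_mem (valP z).
Qed.

Lemma proj_glue (i : nat) (t : R) :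
  (i < g)%N -> 2 * i%:R <= t <= 2 * i%:R + 1 ->
  proj (B t) = proj (B (t + 1)).
Proof.
move=> ig ti; apply/proj_eq/rst_step; exists i, t.
by split=> //; rewrite val_to_disc ?sqn_boundary.
Qed.

(** The gluing of [t] with [t + 1] holds at both ends of an even side, so it links every corner with
    the next one. *)
Lemma proj_corner (k : nat) : (k <= g.*2)%N -> proj (B k%:R) = proj (B 0).
Proof.
elim: k => // k IH kg; rewrite -(IH (ltnW kg)) -[in LHS]addn1 natrD.
rewrite -(@proj_glue k./2) //; first by lia.
by rewrite -natrM natr1 !ler_nat; lia.
Qed.

Lemma proj_side (i : nat) (t u : R) : (i < g)%N ->
  2 * i%:R < t < 2 * i%:R + 1 -> 0 <= u < 2 * g%:R ->
  proj (B t) = proj (B u) -> u = t \/ u = t + 1.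
Proof.
move=> ig /andP[ti0 ti1] /andP[u0 uG] /proj_eq.
(* As [t] is strictly inside side [2i], the two points of [C] are closed under pairing in both
   directions. *)
pose C (z : @unit_disc R) := val z = B t \/ val z = B (t + 1).
have ig' : i%:R + 1 <= g%:R :> R by rewrite natr1 ler_nat.
have i0 : 0 <= i%:R :> R := ler0n _ _.
have bi (v w : R) : B v = B w -> `|v - w| < 2 * g%:R -> v = w.
  by move=> h hv; apply: boundary_inj h.
suff H z w : clos_refl_sym_trans _ (@side_pairing R g) z w -> C z <-> C w.
  move=> /H [+ _]; rewrite /C !val_to_disc ?sqn_boundary//.
  by move=> /(_ (or_introl erefl))[] /bi; rewrite ltr_norml => h;
    [left|right]; apply: h; lra.
elim=> {z w} [z w [j [v [jg /andP[v0 v1] zv wv]]]|z //|z w _ ->//|z w x _ -> _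
  ->//].
have jg' : j%:R + 1 <= g%:R :> R by rewrite natr1 ler_nat.
have j0 : 0 <= j%:R :> R := ler0n _ _.
have ij : ~ ((j%:R : R) < i%:R + 1 /\ (i%:R : R) < j%:R).
  by rewrite natr1 !ltr_nat ltnS leqNgt => -[/negP].
have ji : ~ ((j%:R : R) < i%:R /\ (i%:R : R) < j%:R + 1).
  by rewrite natr1 !ltr_nat => -[ji]; rewrite ltnS leqNgt ji.
rewrite /C zv wv; split=> -[] /bi; rewrite ltr_norml.
- by move=> ->; [right|lra].
- by move=> vt; exfalso; apply: ij; split; lra.
- by move=> vt; exfalso; apply: ji; split; lra.
- move=> vt; left; have {}vt : v + 1 = t + 1 by apply: vt; lra.
  by congr (B _); lra.
Qed.

End Surface.

(** * Arcs and chords on the surface *)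

(** Continuity is required on the whole line, so that affine reparametrisations compose without
    subspace topologies. *)
Definition is_arc (R : realType) (T : topologicalType) (A : set T) (x y : T) :=
  exists f : R -> T,
    [/\ continuous f, set_inj `[0, 1] f, f 0 = x, f 1 = y & f @` `[0, 1] = A].

Section Arcs.
Variables (R : realType) (T : topologicalType).

(* [lra] fails on hypotheses that equate points of a space. *)
Ltac lraT :=
  repeat match goal with H : @eq ?U _ _ |- _ =>
    tryif first [unify U bool | unify U (R : Type)] then fail else clear H end;
  lra.

Lemma is_arc_cat (A B : set T) (x y z : T) :
  is_arc R A x y -> is_arc R B y z -> A `&` B `<=` [set y] ->
  is_arc R (A `|` B) x z.
Proof.
move=> [f [cf fi f0 f1 fA]] [h [ch hi h0 h1 hB]] AB.
pose l (s : R) := 2 * s; pose r (s : R) := 2 * s - 1.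
have cl : continuous l by move=> s; apply: cvgM; [exact: cvg_cst|exact: cvg_id].
have cr : continuous r by move=> s; apply: cvgB; [exact: cl|exact: cvg_cst].
pose k s := if s <= 2^-1 then f (l s) else h (r s).
have kl s : s <= 2^-1 -> k s = f (l s) by rewrite /k => ->.
have kr s : 2^-1 <= s -> k s = h (r s).
  rewrite /k => s2; case: ifP => // s2'.
  have -> : s = 2^-1 by apply/eqP; rewrite eq_le s2 s2'.
  by rewrite /l /r divff// subrr f1 h0.
have half0 : (0 : R) < 2^-1 by rewrite invr_gt0 ltr0n.
have half1 : (2^-1 : R) < 1 by rewrite invf_lt1 ?ltr1n// ltr0n.
have inA s : 0 <= s <= 2^-1 -> A (k s).
  move=> /andP[s0 s1]; rewrite kl// -fA; exists (l s) => //.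
  by rewrite /= in_itv /l /=; lraT.
have inB s : 2^-1 <= s <= 1 -> B (k s).
  move=> /andP[s0 s1]; rewrite kr// -hB; exists (r s) => //.
  by rewrite /= in_itv /r /=; lraT.
have ky s : 0 <= s <= 1 -> k s = y -> s = 2^-1.
  move=> /andP[s0 s1]; case: (leP s 2^-1) => s2;
    [rewrite kl//|rewrite kr ?ltW//].
    rewrite -f1 => /fi; rewrite !inE /= !in_itv /= /l => h'.
    suff : 2 * s = 1 by lraT.
    by apply: h'; lraT.
  rewrite -h0 => /hi; rewrite !inE /= !in_itv /= /r => h'.
  suff : 2 * s - 1 = 0 by lraT.
  by apply: h'; lraT.
exists k; split.
- apply/continuous_subspace_setT.
  have -> : [set: R] = [set s | s <= 2^-1] `|` [set s | 2^-1 <= s].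
    by apply/seteqP; split=> // s _ /=; case: (leP s 2^-1); [left|right;
      exact: ltW].
  apply: withinU_continuous; [exact: closed_le|exact: closed_ge| |].
  - apply: (@subspace_eq_continuous _ _ _ (f \o l)).
      by move=> s /set_mem /kl.
    by apply: continuous_subspaceT => s; apply: continuous_comp;
      [exact: cl|exact: cf].
  - apply: (@subspace_eq_continuous _ _ _ (h \o r)).
      by move=> s /set_mem /kr.
    by apply: continuous_subspaceT => s; apply: continuous_comp;
      [exact: cr|exact: ch].
- move=> s t; rewrite !inE /= !in_itv /= => /andP[s0 s1] /andP[t0 t1].
  wlog st : s t s0 s1 t0 t1 / s <= t.
    by move=> H; case: (leP s t) => [|/ltW] st e; [exact: H|apply/esym/H].
  move=> e.
  case: (leP t 2^-1) => t2.
    move: e; rewrite !kl//; last exact: le_trans t2.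
    move=> /fi; rewrite !inE /= !in_itv /= /l => h'.
    suff : 2 * s = 2 * t by lraT.
    by apply: h'; lraT.
  case: (leP 2^-1 s) => s2.
    move: e; rewrite !kr ?(ltW t2)//.
    move=> /hi; rewrite !inE /= !in_itv /= /r => h'.
    suff : 2 * s - 1 = 2 * t - 1 by lraT.
    by apply: h'; lraT.
  have eky : k s = y.
    by apply: AB; split; [|rewrite e]; [apply: inA|apply: inB]; lraT.
  have s01 : 0 <= s <= 1 by rewrite s0 s1.
  have t01 : 0 <= t <= 1 by rewrite t0 t1.
  by rewrite (ky s s01 eky) (ky t t01 (etrans (esym e) eky)).
- by rewrite kl ?ltW// /l mulr0.
- by rewrite kr ?ltW// -h1; congr h; rewrite /r; lraT.
- apply/seteqP; split=> [_ [s /= + <-]|w] /=.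
    rewrite in_itv /= => /andP[s0 s1].
    by case: (leP s 2^-1) => s2; [left; apply: inA|right; apply: inB]; lraT.
  case; [rewrite -fA|rewrite -hB] => -[s /=];
    rewrite in_itv /= => /andP[s0 s1] <-.
    exists (s / 2); first by rewrite in_itv /=; lraT.
    by rewrite kl; [congr f; rewrite /l; lraT|lraT].
  exists ((s + 1) / 2); first by rewrite in_itv /=; lraT.
  by rewrite kr; [congr h; rewrite /r; lraT|lraT].
Qed.

End Arcs.

Section Chords.
Variables (R : realType) (g : nat).
Hypothesis g_gt0 : (0 < g)%N.
Notation S := (nonorientable_surface R g).
Notation B := (@boundary R g).
Notation pr := (@proj R g).
Implicit Types p q s t : R.

Let dom t := 0 <= t < 2 * g%:R.

Definition segment p q : set (R * R) := point_on (B p) (B q) @` `[0, 1].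

Definition chord p q : set S := pr @` segment p q.

Lemma continuous_affine (a b c a' b' c' : R) :
  continuous (fun z : R * R => (a + b * z.1 + c * z.2,
    a' + b' * z.1 + c' * z.2)).
Proof.
have H (x y w : R) : continuous (fun z : R * R => x + y * z.1 + w * z.2).
  move=> z; apply: cvgD; [apply: cvgD; [exact: cvg_cst|]|]; apply: cvgM;
    by [exact: cvg_cst|exact: cvg_fst|exact: cvg_snd].
move=> z.
exact: (@cvg_pair _ R R (nbhs z) (nbhs (a + b * z.1 + c * z.2))
  (nbhs (a' + b' * z.1 + c' * z.2)) _ _ _ (fun z => a + b * z.1 + c * z.2)
  (fun z => a' + b' * z.1 + c' * z.2) (H _ _ _ z) (H _ _ _ z)).
Qed.

Lemma continuous_point_on (a b : R * R) : continuous (point_on a b).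
Proof.
move=> s.
have H (x y : R) : (fun s : R => x + s * y) @ s --> x + s * y.
  by apply: cvgD; [exact: cvg_cst|apply: cvgM; [exact: cvg_id|exact: cvg_cst]].
exact: (@cvg_pair R R R (nbhs s) (nbhs (a.1 + s * (b.1 - a.1)))
  (nbhs (a.2 + s * (b.2 - a.2))) _ _ _ (fun s => a.1 + s * (b.1 - a.1))
  (fun s => a.2 + s * (b.2 - a.2)) (H _ _) (H _ _)).
Qed.

Let frame (a u v z : R * R) : R * R :=
  (a.1 + u.1 * z.1 + v.1 * z.2, a.2 + u.2 * z.1 + v.2 * z.2).

Let det (u v : R * R) : R := u.1 * v.2 - u.2 * v.1.

(** The inverse of [frame], by Cramer's rule. *)
Let coframe (a u v w : R * R) : R * R :=
  ((v.1 * a.2 - v.2 * a.1) / det u v + (v.2 / det u v) * w.1 +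
     (- v.1 / det u v) * w.2,
   (u.2 * a.1 - u.1 * a.2) / det u v + (- u.2 / det u v) * w.1 +
     (u.1 / det u v) * w.2).

Let frameK a u v : det u v != 0 -> cancel (frame a u v) (coframe a u v).
Proof.
move: a u v => [a1 a2] [u1 u2] [v1 v2]; rewrite /det /= => D0 [w1 w2].
by rewrite /frame /coframe /det /=; congr pair; field.
Qed.

Let coframeK a u v : det u v != 0 -> cancel (coframe a u v) (frame a u v).
Proof.
move: a u v => [a1 a2] [u1 u2] [v1 v2]; rewrite /det /= => D0 [w1 w2].
by rewrite /frame /coframe /det /=; congr pair; field.
Qed.

Lemma closed_segment p q : closed (segment p q).
Proof.
apply: compact_closed; first exact: norm_hausdorff.
apply: continuous_compact; last exact: segment_compact.
by apply: continuous_subspaceT; exact: continuous_point_on.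
Qed.

Lemma boundary_neq p q : dom p -> dom q -> p != q -> B p != B q.
Proof.
move=> /andP[p0 p1] /andP[q0 q1]; apply: contra => /eqP /boundary_inj h.
by rewrite h//; rewrite ltr_norml; lra.
Qed.

Lemma sqn_point_on_lt1 p q s : dom p -> dom q -> p != q ->
  (sqn (point_on (B p) (B q) s) < 1) = (0 < s < 1).
Proof.
move=> dp dq pq; rewrite sqn_point_on ?sqn_boundary//.
have := sqn_gt0 (_ : B q - B p != 0); rewrite subr_eq0 eq_sym boundary_neq//
  => /(_ isT).
move: (sqn _) => n n0.
rewrite ltrBlDr ltrDl pmulr_lgt0//.
apply/idP/idP => [h|/andP[s0 s1]]; last by rewrite mulr_gt0// subr_gt0.
apply/andP; split; nra.
Qed.

Lemma segment_disc p q : segment p q `<=` [set z | sqn z <= 1].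
Proof.
move=> _ [s /= + <-]; rewrite in_itv /= => /andP[s0 s1].
rewrite sqn_point_on ?sqn_boundary// gerBl mulr_ge0// ?mulr_ge0 ?subr_ge0//.
by rewrite addr_ge0 ?sqr_ge0.
Qed.

Lemma chord_arc p q : dom p -> dom q -> pr (B p) <> pr (B q) ->
  is_arc R (chord p q) (pr (B p)) (pr (B q)).
Proof.
move=> dp dq npq.
have pq : p != q by apply/eqP => e; apply: npq; rewrite e.
exists (pr \o point_on (B p) (B q)); split.
- move=> s; apply: continuous_comp; first exact: continuous_point_on.
  exact: continuous_proj.
- move=> s t; rewrite !inE => sI tI /= e.
  have [s01|s01] := boolP (0 < s < 1).
    apply: (point_on_inj (boundary_neq dp dq pq)).
    apply: (proj_inj_interior _ _ e); first by rewrite sqn_point_on_lt1.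
    by apply: (@segment_disc p q); exists t.
  have [t01|t01] := boolP (0 < t < 1).
    apply: (point_on_inj (boundary_neq dp dq pq)); apply/esym.
    apply: (proj_inj_interior _ _ (esym e)); first by rewrite sqn_point_on_lt1.
    by apply: (@segment_disc p q); exists s.
  have E (x : R) : `[0, 1]%classic x -> ~~ (0 < x < 1) -> x = 0 \/ x = 1.
    rewrite /= in_itv /= !le_eqVlt => /andP[/predU1P[<-|->]]; first by left.
    by move=> /predU1P[->|->]//; right.
  case: (E s sI s01) (E t tI t01) e => -> [] -> //;
    rewrite ?point_on0 ?point_on1 => // h.
  by case: npq; rewrite h.
- by rewrite /= point_on0.
- by rewrite /= point_on1.
- by rewrite /chord /segment image_comp.
Qed.

(** A common point in the open disc is already common in the plane, hence a crossing; otherwise it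
    comes from an endpoint of each chord. Equal chords are excluded in both directions. *)
Lemma chord_meet p q p' q' (x : S) : dom p -> dom q -> dom p' -> dom q' ->
  p != q -> p' != q' ->
  ~~ ((p == p') && (q == q')) -> ~~ ((p == q') && (q == p')) ->
  chord p q x -> chord p' q' x ->
  (exists s t, [/\ interlaced <%R p q p' q', 0 < s < 1, 0 < t < 1,
     point_on (B p) (B q) s = point_on (B p') (B q') t
     & x = pr (point_on (B p) (B q) s)]) \/
  exists u v, [/\ u = p \/ u = q, v = p' \/ v = q',
    x = pr (B u) & x = pr (B v)].
Proof.
move=> dp dq dp' dq' pq pq' n1 n2 [_ [s s01 <-] <-] [_ [t t01 <-] e].
have E (y : R) : `[0, 1]%classic y -> ~~ (0 < y < 1) -> y = 0 \/ y = 1 :> R.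
  rewrite /= in_itv /= !le_eqVlt => /andP[/predU1P[<-|->]]; first by left.
  by move=> /predU1P[->|->]//; right.
have [si|si] := boolP (0 < s < 1).
  have e' : point_on (B p) (B q) s = point_on (B p') (B q') t.
    apply: (proj_inj_interior _ _ (esym e)); first by rewrite sqn_point_on_lt1.
    by apply: (@segment_disc p' q'); exists t.
  have ti : 0 < t < 1 by rewrite -(sqn_point_on_lt1 _ dp' dq')// -e'
    sqn_point_on_lt1.
  left; exists s, t; split=> //; apply: contraPT e' => nI.
  exact: chords_disjoint nI n1 n2 ti.
have [ti|ti] := boolP (0 < t < 1).
  have e' : point_on (B p') (B q') t = point_on (B p) (B q) s.
    apply: (proj_inj_interior _ _ e); first by rewrite sqn_point_on_lt1.
    by apply: (@segment_disc p q); exists s.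
  by move: si; rewrite -(sqn_point_on_lt1 _ dp dq)// -e' sqn_point_on_lt1 ?ti.
right; exists (if s == 0 then p else q), (if t == 0 then p' else q'); split.
- by case: ifP; [left|right].
- by case: ifP; [left|right].
- by case: (E s s01 si) => ->; rewrite ?eqxx ?oner_eq0 ?point_on0 ?point_on1.
- by rewrite -e; case: (E t t01 ti) => ->;
    rewrite ?eqxx ?oner_eq0 ?point_on0 ?point_on1.
Qed.

(** [K] and [K'] stand for the other chords of the two edges. The chart is the affine frame with
    axes along the two chords, restricted to the part of the open disc that avoids [K] and [K']. *)
Lemma chord_crosses p q p' q' (K K' : set (R * R)) s t :
  dom p -> dom q -> dom p' -> dom q' -> interlaced <%R p q p' q' ->
  0 < s < 1 -> point_on (B p) (B q) s = point_on (B p') (B q') t ->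
  closed K -> closed K' ->
  K `<=` [set z | sqn z <= 1] -> K' `<=` [set z | sqn z <= 1] ->
  ~ K (point_on (B p) (B q) s) -> ~ K' (point_on (B p) (B q) s) ->
  crosses_at R (chord p q `|` pr @` K) (chord p' q' `|` pr @` K')
    (pr (point_on (B p) (B q) s)).
Proof.
move=> dp dq dp' dq' il s01 e cK cK' K1 K1' nK nK'.
have [il1 il2] := chords_cross g_gt0 dp dq dp' dq' il.
set z0 := point_on (B p) (B q) s in e nK nK' *.
pose u := B q - B p; pose v := B q' - B p'.
pose D := det u v.
(* Parallel chords would give [B p'] and [B q'] the same orientation, against [il1]. *)
have D0 : D != 0.
  apply/eqP => D0; suff E : orient (B p) (B q) (B p') = orient (B p) (B q) (B
    q').
    by move: il1; rewrite E -expr2 ltNge sqr_ge0.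
  apply/eqP; rewrite -subr_eq0 -oppr_eq0 -[X in _ == X]D0 /D /det /u /v
    /orient /=; apply/eqP; ring.
pose c := frame z0 u v; pose c' := coframe z0 u v.
have cc' : cancel c' c := coframeK z0 D0.
have c'c : cancel c c' := frameK z0 D0.
have c00 : c (0, 0) = z0.
  by rewrite /c /frame; move: (z0) => [z1 z2]; rewrite /= !mulr0 !addr0.
have Oc : continuous c by exact: continuous_affine.
have Oc' : continuous c' by exact: continuous_affine.
pose O := [set z : R * R | sqn z < 1] `&` ~` K `&` ~` K'.
have oO : open O.
  apply: openI; last exact: closed_openC.
  apply: openI; last exact: closed_openC.
  rewrite (_ : [set _ | _] = @sqn R @^-1` [set x | x < 1]) //.
  by move/continuousP: (@continuous_sqn R); apply; exact: open_lt.
(* Up to the factor [D], the orientation with respect to a chord is the coordinate that vanishes on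
   it. *)
have on1 z : orient (B p) (B q) (c z) = D * z.2.
  have -> : orient (B p) (B q) (c z) = orient (B p) (B q) z0 + D * z.2.
    by rewrite /orient /c /frame /D /det /u /=; ring.
  by rewrite /z0 orient_point_on_self add0r.
have on2 z : orient (B p') (B q') (c z) = - D * z.1.
  have -> : orient (B p') (B q') (c z) = orient (B p') (B q') z0 - D * z.1.
    by rewrite /orient /c /frame /D /det /v /=; ring.
  by rewrite e orient_point_on_self add0r mulNr.
have npq : p != q.
  by apply/eqP => pq; move: il1; rewrite pq /orient !subrr !mul0r subrr mul0r
    ltxx.
have npq' : p' != q'.
  by apply/eqP => pq; move: il2; rewrite pq /orient !subrr !mul0r subrr mul0r
    ltxx.
exists (c @^-1` O), (pr \o c); split.
- split; first by move/continuousP: Oc; apply.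
  rewrite /preimage /= c00.
  by split=> //; split=> //; rewrite /= /z0 sqn_point_on_lt1.
- by rewrite /= c00.
- split.
    by move=> z _; apply: continuous_comp; [exact: Oc|exact: continuous_proj].
  move=> z w; rewrite !inE => -[[z1 _] _] [[w1 _] _] /= h.
  by apply: (can_inj c'c); apply: (proj_inj_interior _ _ h) => //; exact: ltW.
- move=> U oU UW; rewrite -image_comp; apply: open_proj.
    have -> : c @` U = c' @^-1` U.
      apply/seteqP; split=> [_ [z Uz <-]|z Uz]; first by rewrite /= c'c.
      by exists (c' z).
    by move/continuousP: Oc'; apply.
  by move=> _ [z /UW[[]] + _ _ <-].
- move=> z [[z1 nKz] nKz'] /=; split; split.
  + case=> [[w wI] h|[w Kw] h].
      have cw : c z = w by apply: (proj_inj_interior _ _ (esym h)) => //;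
        exact: segment_disc wI.
      have := on1 z; rewrite cw; case: wI => r _ <-;
        rewrite orient_point_on_self.
      by move=> /esym/eqP; rewrite mulf_eq0 (negbTE D0) => /eqP.
    have cw : c z = w by apply: (proj_inj_interior _ _ (esym h)) => //;
      exact: K1.
    by case: nKz; rewrite cw.
  + move=> z20; left; exists (c z) => //.
    have E : c z = point_on (B p) (B q) (s + z.1).
      by rewrite /c /frame z20 /z0 /u /point_on /=; congr pair; ring.
    exists (s + z.1) => //=; rewrite in_itv /=.
    by move: z1; rewrite E /= sqn_point_on_lt1// => /andP[/ltW -> /ltW ->].
  + case=> [[w wI] h|[w Kw] h].
      have cw : c z = w by apply: (proj_inj_interior _ _ (esym h)) => //;
        exact: segment_disc wI.
      have := on2 z; rewrite cw; case: wI => r _ <-;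
        rewrite orient_point_on_self.
      by move=> /esym/eqP; rewrite mulf_eq0 oppr_eq0 (negbTE D0) => /eqP.
    have cw : c z = w by apply: (proj_inj_interior _ _ (esym h)) => //;
      exact: K1'.
    by case: nKz'; rewrite cw.
  + move=> z10; left; exists (c z) => //.
    have E : c z = point_on (B p') (B q') (t + z.2).
      by rewrite /c /frame z10 e /v /point_on /=; congr pair; ring.
    exists (t + z.2) => //=; rewrite in_itv /=.
    by move: z1; rewrite E /= sqn_point_on_lt1// => /andP[/ltW -> /ltW ->].
Qed.

End Chords.

(* A boundary position is a pair (side, offset), the offset counting fractions
   1 / M of the side; positions with offset 0 are the corners. *)
Section Positions.
Variables (R : realType) (g M : nat).
Hypotheses (g_gt0 : (0 < g)%N) (M_gt0 : (0 < M)%N).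
Notation S := (nonorientable_surface R g).
Implicit Types p q : nat * nat.

Definition valid_pos p : bool := (p.1 < g.*2)%N && (p.2 < M)%N.

Definition pos_lt p q : bool :=
  ((p.1 < q.1) || (p.1 == q.1) && (p.2 < q.2))%N.

(** A name for the point of the surface: paired sides have the same half, glued points the same
    offset, and all corners share one class. *)
Definition pos_class p : nat * nat :=
  if p.2 == 0 then (0, 0) else (p.1./2, p.2).

Definition pos_param p : R := p.1%:R + p.2%:R / M%:R.

Definition pos_point p : S := proj g (boundary g (pos_param p)).

Let M0 : (0 : R) < M%:R. Proof. by rewrite ltr0n. Qed.

Let offset_lt1 p : valid_pos p -> 0 <= (p.2%:R : R) / M%:R < 1.
Proof.
move=> /andP[_ pM]; apply/andP; split; first by rewrite divr_ge0.
by rewrite ltr_pdivrMr// mul1r ltr_nat.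
Qed.

Lemma pos_param_lt p q : valid_pos p -> valid_pos q ->
  (pos_param p < pos_param q) = pos_lt p q.
Proof.
move=> vp vq; have /andP[p0 p1] := offset_lt1 vp;
  have /andP[q0 q1] := offset_lt1 vq.
rewrite /pos_param /pos_lt.
case: ltngtP => [pq|pq|->] /=.
- have : p.1%:R + 1 <= q.1%:R :> R by rewrite natr1 ler_nat.
  by move=> h; apply/idP; lra.
- have : q.1%:R + 1 <= p.1%:R :> R by rewrite natr1 ler_nat.
  by move=> h; apply/negbTE; rewrite -leNgt; lra.
- by rewrite ltrD2l ltr_pM2r ?invr_gt0// ltr_nat.
Qed.

Lemma pos_param_dom p : valid_pos p -> 0 <= pos_param p < 2 * g%:R.
Proof.
move=> vp; have /andP[p0 p1] := offset_lt1 vp; move: vp => /andP[pg _].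
have : p.1%:R + 1 <= 2 * g%:R :> R by rewrite natr1 -natrM ler_nat mul2n.
have : 0 <= p.1%:R :> R by [].
by rewrite /pos_param; lra.
Qed.

Lemma pos_param_inj p q : valid_pos p -> valid_pos q ->
  pos_param p = pos_param q -> p = q.
Proof.
move=> vp vq e.
have : pos_lt p q = false by rewrite -pos_param_lt// e ltxx.
have : pos_lt q p = false by rewrite -pos_param_lt// e ltxx.
rewrite /pos_lt (surjective_pairing p) (surjective_pairing q) /=.
by move=> h1 h2; congr pair; lia.
Qed.

Lemma pos_point_eq p q : valid_pos p -> valid_pos q ->
  pos_point p = pos_point q <-> pos_class p = pos_class q.
Proof.
pose inner p := p.2 != 0.
have corner p' : valid_pos p' -> ~~ inner p' -> pos_point p' = proj g
  (boundary g 0).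
  move=> /andP[pg _]; rewrite negbK => /eqP p0.
  by rewrite /pos_point /pos_param p0 mul0r addr0 proj_corner// ltnW.
have side p' : valid_pos p' -> inner p' -> 2 * (p'.1./2)%:R < pos_param
  (p'.1./2.*2, p'.2) < 2 * (p'.1./2)%:R + 1.
  move=> vp np; rewrite /pos_param /= -mul2n natrM.
  have /andP[p0 p1] := offset_lt1 vp.
  have : 0 < p'.2%:R / M%:R :> R by rewrite divr_gt0// ltr0n lt0n.
  by move=> h; rewrite ltrDl h ltrD2l.
(* Moves an inner position to the even side of its pair, where [proj_side] applies. *)
have base p' : valid_pos p' -> inner p' -> pos_point p' = pos_point
  (p'.1./2.*2, p'.2).
  move=> vp np; have /andP[s1 s2] := side p' vp np; move: (vp) => /andP[pg _].
  rewrite [in LHS](surjective_pairing p') -[in LHS](odd_double_half p'.1).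
  case: (odd p'.1) => //=.
  rewrite /pos_point (@proj_glue _ _ p'.1./2 (pos_param (p'.1./2.*2, p'.2))).
  - by congr (proj _ (boundary _ _)); rewrite /pos_param /= add1n -natr1; ring.
  - lia.
  - by rewrite (ltW s1) (ltW s2).
have mixed p' : valid_pos p' -> inner p' -> pos_point p' <> proj g (boundary g
  0).
  move=> vp np; rewrite base// => e; have /andP[s1 s2] := side p' vp np.
  move: (vp) => /andP[pg _]; have pg' : (p'.1./2 < g)%N by lia.
  have h0 : 0 <= p'.1./2%:R :> R by [].
  have [|E|E] := proj_side g_gt0 pg' (side _ vp np) _ e; last 2 first.
  - by move: s1; clear e; lra.
  - by move: s1; clear e; lra.
  by rewrite lexx /= mulr_gt0// ltr0n.
move=> vp vq; rewrite /pos_class.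
split=> [|e].
  case: (boolP (p.2 == 0)) => p0; case: (boolP (q.2 == 0)) => q0 //.
  - by rewrite (corner p) /inner ?negbK// => /esym/(mixed _ vq q0).
  - by rewrite (corner q) /inner ?negbK// => /(mixed _ vp p0).
  - rewrite (base p)// => e.
    move: (vp) => /andP[pg pM].
    have pg' : (p.1./2 < g)%N by lia.
    have [E|E] := proj_side g_gt0 pg' (side _ vp p0) (pos_param_dom vq) e.
      have vp' : valid_pos (p.1./2.*2, p.2) by rewrite /valid_pos /= pM andbT;
        lia.
      by rewrite (pos_param_inj vq vp' E) /= doubleK.
    have E' : pos_param q = pos_param (p.1./2.*2.+1, p.2).
      by rewrite E /pos_param /= -natr1; ring.
    have vp' : valid_pos (p.1./2.*2.+1, p.2) by rewrite /valid_pos /= pM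
      andbT; lia.
    by rewrite (pos_param_inj vq vp' E') /= uphalf_double.
move: e; case: (boolP (p.2 == 0)) => p0; case: (boolP (q.2 == 0)) => q0 //.
- by rewrite (corner p) ?(corner q)// /inner negbK.
- by move=> [_ q00]; rewrite -q00 in q0.
- by move=> [_ p00]; rewrite p00 in p0.
- by move=> [e1 e2]; rewrite (base p)// (base q)// e1 e2.
Qed.

Lemma interlaced_param p q p' q' :
  valid_pos p -> valid_pos q -> valid_pos p' -> valid_pos q' ->
  interlaced <%R (pos_param p) (pos_param q) (pos_param p') (pos_param q') =
  interlaced pos_lt p q p' q'.
Proof. by move=> vp vq vp' vq'; rewrite /interlaced /alternate !pos_param_lt.
  Qed.

End Positions.

(** * Chord systems *)

(* Edge l is the concatenation of the chords from [st l r] to [en l r],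
   r <= m l; the end of a chord is glued to the start of the next one. *)
Section ChordSystem.
Variables (g M : nat) (V L : finType) (ep : L -> V * V) (vp : V -> nat * nat).
Variables (m : L -> nat) (st en : L -> nat -> nat * nat).
Local Notation cls := pos_class.

Definition ends (l : L) : {set V} := [set (ep l).1; (ep l).2]%SET.

Definition linked l r l' r' : bool :=
  interlaced pos_lt (st l r) (en l r) (st l' r') (en l' r').

Record chord_system : Prop := ChordSystem {
  cs_ends : forall l, (ep l).1 != (ep l).2;
  cs_ends_inj : injective ends;
  cs_vertex : forall v, valid_pos g M (vp v);
  cs_vertex_inj : injective (cls \o vp);
  cs_valid : forall l r, (r <= m l)%N ->
    valid_pos g M (st l r) && valid_pos g M (en l r);
  cs_glue : forall l r, (r < m l)%N -> cls (st l r.+1) = cls (en l r);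
  cs_start : forall l, cls (st l 0) = cls (vp (ep l).1);
  cs_stop : forall l, cls (en l (m l)) = cls (vp (ep l).2);
  cs_inner : forall l r v, (r < m l)%N -> cls (en l r) != cls (vp v);
  cs_inner_inj : forall l r l' r', (r < m l)%N -> (r' < m l')%N ->
    cls (en l r) = cls (en l' r') -> l = l' /\ r = r';
  cs_self : forall l r r', (r < r' <= m l)%N -> ~~ linked l r l r';
  cs_adjacent : forall l l' r r', l != l' -> ends l :&: ends l' != finset.set0
    ->
    (r <= m l)%N -> (r' <= m l')%N -> ~~ linked l r l' r';
  cs_cross : forall l l', ends l :&: ends l' = finset.set0 ->
    exists r r', [/\ (r <= m l)%N, (r' <= m l')%N, linked l r l' r' &
      forall s s', (s <= m l)%N -> (s' <= m l')%N -> linked l s l' s' ->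
        s = r /\ s' = r'] }.

Variable R : realType.
Hypotheses (g_gt0 : (0 < g)%N) (M_gt0 : (0 < M)%N) (CS : chord_system).
Notation S := (nonorientable_surface R g).
Notation B := (@boundary R g).
Let pp (p : nat * nat) : S := pos_point R g M p.
Let par (p : nat * nat) : R := pos_param R M p.
Local Notation pt l r := (point_on (B (par (st l r))) (B (par (en l r)))).
Let ch l r : set S := @chord R g (par (st l r)) (par (en l r)).

(** The classes of the boundary points that edge [l] visits, numbered from 0 to [m l + 1]. *)
Let nd l i : nat * nat := if i is i'.+1 then cls (en l i') else cls (st l 0).

Let nd_st l r : (r <= m l)%N -> cls (st l r) = nd l r.
Proof. by case: r => // r rm; rewrite (cs_glue CS rm). Qed.

Let ndP l i : (i <= (m l).+1)%N ->
  [\/ i = 0 /\ nd l i = cls (vp (ep l).1),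
      i = (m l).+1 /\ nd l i = cls (vp (ep l).2) |
      exists r, [/\ (r < m l)%N, i = r.+1 & nd l i = cls (en l r)]].
Proof.
case: i => [_|i im]; first by constructor 1; rewrite /= (cs_start CS).
have [/eqP ->|ne] := boolP (i == m l); first by constructor 2;
  rewrite /= (cs_stop CS).
by constructor 3; exists i; split=> //; lia.
Qed.

Let nd_inj l i j : (i <= (m l).+1)%N -> (j <= (m l).+1)%N -> nd l i = nd l j ->
  i = j.
Proof.
have vi v w : cls (vp v) = cls (vp w) -> v = w := @cs_vertex_inj CS v w.
have ne := cs_ends CS l.
move=> /ndP[[-> ->]|[-> ->]|[r [rm -> ->]]] /ndP[[-> ->]|[-> ->]|[r' [rm' ->
  ->]]] //.
- by move=> /vi e; rewrite e eqxx in ne.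
- by move=> /esym/eqP; rewrite (negbTE (cs_inner CS _ rm')).
- by move=> /vi e; rewrite e eqxx in ne.
- by move=> /esym/eqP; rewrite (negbTE (cs_inner CS _ rm')).
- by move=> /eqP; rewrite (negbTE (cs_inner CS _ rm)).
- by move=> /eqP; rewrite (negbTE (cs_inner CS _ rm)).
- by move=> /(cs_inner_inj CS rm rm')[_ ->].
Qed.

Let nd_vertex l i v : (i <= (m l).+1)%N -> nd l i = cls (vp v) ->
  v \in ends l /\ (i = 0 \/ i = (m l).+1).
Proof.
move=> /ndP[[-> ->]|[-> ->]|[r [rm -> ->]]].
- by move=> /(@cs_vertex_inj CS) <-; rewrite !inE eqxx; split; [|left].
- by move=> /(@cs_vertex_inj CS) <-; rewrite !inE eqxx orbT; split; [|right].
- by move=> /eqP; rewrite (negbTE (cs_inner CS _ rm)).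
Qed.

Let nd_share l l' i j : l != l' -> (i <= (m l).+1)%N -> (j <= (m l').+1)%N ->
  nd l i = nd l' j ->
  exists2 v, nd l i = cls (vp v) & nd l' j = cls (vp v).
Proof.
move=> ll im jm e; have [[_ h]|[_ h]|[r [rm _ h]]] := ndP im.
- by exists (ep l).1; rewrite -?e.
- by exists (ep l).2; rewrite -?e.
have [[_ h']|[_ h']|[r' [rm' _ h']]] := ndP jm.
- by exists (ep l').1; rewrite ?e.
- by exists (ep l').2; rewrite ?e.
move: e; rewrite h h' => /(cs_inner_inj CS rm rm')[e _].
by rewrite e eqxx in ll.
Qed.

Let va l r : (r <= m l)%N -> valid_pos g M (st l r).
Proof. by move=> /(cs_valid CS)/andP[]. Qed.
Let vb l r : (r <= m l)%N -> valid_pos g M (en l r).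
Proof. by move=> /(cs_valid CS)/andP[]. Qed.

Let par_inj p q : valid_pos g M p -> valid_pos g M q -> par p = par q -> p = q.
Proof. exact: pos_param_inj. Qed.

Let pp_eq p q : valid_pos g M p -> valid_pos g M q -> pp p = pp q ->
  cls p = cls q.
Proof. by move=> vp' vq' /(pos_point_eq R g_gt0 M_gt0 vp' vq'). Qed.

Let chord_neq l r : (r <= m l)%N -> par (st l r) != par (en l r).
Proof.
move=> rm; apply/eqP => /(par_inj (va rm) (vb rm)) /(congr1 cls).
by rewrite nd_st// => /(@nd_inj l r r.+1) h; have := h ltac:(lia) ltac:(lia);
  lia.
Qed.

(** The nodes of one edge are distinct, and two edges with two common nodes would have the same
    ends. This supplies the side conditions of [chord_meet]. *)
Let chord_eq l r l' r' : (r <= m l)%N -> (r' <= m l')%N ->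
  (nd l r = nd l' r' /\ nd l r.+1 = nd l' r'.+1) \/
  (nd l r = nd l' r'.+1 /\ nd l r.+1 = nd l' r') -> l = l' /\ r = r'.
Proof.
move=> rm rm' h.
have [/eqP ll|ll] := boolP (l == l').
  split=> //; subst l'; case: h => -[/nd_inj h1 /nd_inj h2];
    first by apply: h1; lia.
  have := h1 ltac:(lia) ltac:(lia); have := h2 ltac:(lia) ltac:(lia); lia.
exfalso; move/negP: (ll); apply; apply/eqP/(cs_ends_inj CS).
have E v w x y : nd l r = cls (vp v) -> nd l r.+1 = cls (vp w) ->
    nd l' x = cls (vp v) -> nd l' y = cls (vp w) ->
    (x <= (m l').+1)%N -> (y <= (m l').+1)%N -> x <> y -> ends l = ends l'.
  move=> e1 e2 e3 e4 xm ym xy.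
  have [v1 c1] := nd_vertex (leqW rm) e1;
    have [w1 c2] := nd_vertex (rm : (r.+1 <= _.+1)%N) e2.
  have [v2 _] := nd_vertex xm e3; have [w2 _] := nd_vertex ym e4.
  have vw : v != w by apply/eqP => vw; apply: xy; apply: (@nd_inj l') => //;
    rewrite e3 e4 vw.
  have H k : v \in ends k -> w \in ends k -> ends k = [set v; w]%SET.
    rewrite /ends; have := cs_ends CS k; move: (ep k) => [x1 x2] /= x12.
    rewrite !inE => /orP[]/eqP h1 /orP[]/eqP h2; move: vw;
      rewrite h1 h2 ?eqxx//.
    by rewrite finset.setUC.
  by rewrite (H l)// (H l').
case: h => -[e1 e2].
  have [v a1 a2] := nd_share ll (leqW rm) (leqW rm') e1.
  have [w b1 b2] := nd_share ll (rm : (r.+1 <= _.+1)%N) (rm' : (r'.+1 <=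
    _.+1)%N) e2.
  by apply: (E v w r' r'.+1) => //; lia.
have [v a1 a2] := nd_share ll (leqW rm) (rm' : (r'.+1 <= _.+1)%N) e1.
have [w b1 b2] := nd_share ll (rm : (r.+1 <= _.+1)%N) (leqW rm') e2.
by apply: (E v w r'.+1 r') => //; lia.
Qed.

Let meet l r l' r' (x : S) : (r <= m l)%N -> (r' <= m l')%N ->
  (l, r) <> (l', r') -> ch l r x -> ch l' r' x ->
  (exists s t, [/\ linked l r l' r', 0 < s < 1, 0 < t < 1,
     pt l r s =
     pt l' r' t
     & x = proj g (pt l r s)]) \/
  exists i j, [/\ i = r \/ i = r.+1, j = r' \/ j = r'.+1, nd l i = nd l' j &
    forall p, valid_pos g M p -> cls p = nd l i -> x = pp p].
Proof.
move=> rm rm' ne xl xl'.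
have dom p : valid_pos g M p -> 0 <= par p < 2 * g%:R by exact: pos_param_dom.
have n1 : ~~ ((par (st l r) == par (st l' r')) && (par (en l r) == par (en l'
  r'))).
  apply/negP => /andP[/eqP/par_inj e1 /eqP/par_inj e2]; apply: ne.
  suff [-> ->] : l = l' /\ r = r' by [].
  by apply: chord_eq => //; left; split; [rewrite -!nd_st// e1|rewrite /= e2];
    rewrite ?va ?vb.
have n2 : ~~ ((par (st l r) == par (en l' r')) && (par (en l r) == par (st l'
  r'))).
  apply/negP => /andP[/eqP/par_inj e1 /eqP/par_inj e2]; apply: ne.
  suff [-> ->] : l = l' /\ r = r' by [].
  by apply: chord_eq => //; right; split;
    [rewrite -(nd_st rm) e1|rewrite -(nd_st rm') /= e2]; rewrite ?va ?vb.
have [[s [t [il s01 t01 e xE]]]|[u [v [hu hv xu xv]]]] :=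
  chord_meet g_gt0 (dom _ (va rm)) (dom _ (vb rm)) (dom _ (va rm'))
  (dom _ (vb rm')) (chord_neq rm) (chord_neq rm') n1 n2 xl xl'.
  left; exists s, t; split=> //.
  by rewrite /linked -(interlaced_param R M_gt0 (va rm) (vb rm) (va rm') (vb
    rm')).
right.
have [i [p [hi vp' ip up]]] : exists i p, [/\ i = r \/ i = r.+1,
  valid_pos g M p, cls p = nd l i & u = par p].
  by case: hu => ->; [exists r, (st l r)|exists r.+1, (en l r)]; split;
    rewrite ?nd_st ?va ?vb//; [left|right].
have [j [q [hj vq' jq vq]]] : exists j q, [/\ j = r' \/ j = r'.+1,
  valid_pos g M q, cls q = nd l' j & v = par q].
  by case: hv => ->; [exists r', (st l' r')|exists r'.+1, (en l' r')]; split;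
    rewrite ?nd_st ?va ?vb//; [left|right].
exists i, j; split=> //.
  by rewrite -ip -jq; apply: pp_eq => //;
    rewrite /pp /pos_point -/(par p) -/(par q) -up -vq -xu.
move=> w vw ew; rewrite xu up -/(pp p).
by apply/(pos_point_eq R g_gt0 M_gt0 vp' vw); rewrite ip ew.
Qed.

Let tr l : set S := \bigcup_(r in [set r | (r <= m l)%N]) ch l r.

(** By induction on the number of chords: the next chord is not linked with the earlier ones and
    brings a new node, so it meets them in the joint only. *)
Let edge_arc l : is_arc R (tr l) (pp (vp (ep l).1)) (pp (vp (ep l).2)).
Proof.
have -> : pp (vp (ep l).1) = pp (st l 0).
  by apply/(pos_point_eq R g_gt0 M_gt0); rewrite ?va ?(cs_vertex CS)
    ?(cs_start CS).
have -> : pp (vp (ep l).2) = pp (en l (m l)).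
  by apply/(pos_point_eq R g_gt0 M_gt0); rewrite ?vb ?(cs_vertex CS) ?(cs_stop
    CS).
suff H : forall k, (k <= m l)%N -> is_arc R (\bigcup_(r in [set r | (r <=
  k)%N]) ch l r)
    (pp (st l 0)) (pp (en l k)) by exact: H.
have A k : (k <= m l)%N -> is_arc R (ch l k) (pp (st l k)) (pp (en l k)).
  move=> km; apply: chord_arc => //; try exact: pos_param_dom _ (va km);
    try exact: pos_param_dom _ (vb km).
  move=> /(pp_eq (va km) (vb km)); rewrite nd_st// => /(@nd_inj l k k.+1) h.
  by have := h ltac:(lia) ltac:(lia); lia.
elim=> [_|k IH km].
  rewrite (_ : \bigcup_(r in _) _ = ch l 0); first exact: A.
  apply/seteqP; split=> [x [r /=]|x hx]; last by exists 0.
  by rewrite leqn0 => /eqP ->.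
rewrite (_ : \bigcup_(r in _) _ = (\bigcup_(r in [set r | (r <= k)%N]) ch l r)
  `|` ch l k.+1).
  apply: is_arc_cat (IH (ltnW km)) _ _.
    rewrite (_ : pp (en l k) = pp (st l k.+1)); first exact: A.
    by apply/(pos_point_eq R g_gt0 M_gt0 (vb (ltnW km)) (va km));
      rewrite (cs_glue CS).
  move=> x [[r /= rk xr] xk].
  have rm : (r <= m l)%N by lia.
  have ne : (l, r) <> (l, k.+1) by case; lia.
  case: (meet rm km ne xr xk) => [[s [t [lk _ _ _ _]]]|[i [j [hi hj e h]]]].
    by have := @cs_self CS l r k.+1; rewrite lk => /(_ ltac:(lia)).
  have ij : i = j by apply: (@nd_inj l) => //; lia.
  have ik : i = k.+1 by lia.
  by apply: h; [apply: vb; lia|rewrite ik].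
apply/seteqP; split=> [x [r /= rk hx]|x [[r /= rk hx]|hx]].
- by have [/eqP e|ne] := boolP (r == k.+1); [right; rewrite -e|left;
    exists r => //=; lia].
- by exists r => //=; lia.
- by exists k.+1 => /=.
Qed.

(** A vertex comes from the circle, so it can only be an end of a chord, that is, a node. *)
Let vertex_on l v : tr l (pp (vp v)) -> v \in ends l.
Proof.
move=> [r /= rm [z [s sI <-] e]].
have [dst den] : (0 <= par (st l r) < 2 * g%:R) /\ (0 <= par (en l r) < 2 *
  g%:R).
  by split; apply: pos_param_dom => //; [exact: va|exact: vb].
have si : ~~ (0 < s < 1).
  apply/negP => s01.
  have := proj_inj_interior (_ : sqn (pt l r s) < 1) (_ : sqn (B (par (vp v)))
    <= 1) e.
  rewrite (sqn_point_on_lt1 _ _ dst den)//; last exact: chord_neq.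
  rewrite sqn_boundary => /(_ s01 (lexx _)) h.
  have := sqn_point_on_lt1 g_gt0 s dst den (chord_neq rm).
  by rewrite h sqn_boundary ltxx s01.
have : s = 0 \/ s = 1.
  move: sI si; rewrite /= in_itv /= !le_eqVlt => /andP[/predU1P[<-|->]];
    first by left.
  by move=> /predU1P[->|->]//; right.
case=> s0; move: e; rewrite s0 ?point_on0 ?point_on1 => /pp_eq h.
  by have [] := @nd_vertex l r v (leqW rm);
    rewrite // -nd_st// h ?va ?(cs_vertex CS).
by have [] := @nd_vertex l r.+1 v rm; rewrite //= h ?vb ?(cs_vertex CS).
Qed.

Let on_vertex l v : v \in ends l -> tr l (pp (vp v)).
Proof.
have [f [_ _ f0 f1 fA]] := edge_arc l.
by rewrite -fA !inE => /orP[]/eqP ->; [exists 0|exists 1] => //=;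
  rewrite in_itv /= ?lexx ?ler01.
Qed.

Let meet_edges l l' x : l != l' -> tr l x -> tr l' x ->
  (exists r r' s t, [/\ (r <= m l)%N /\ (r' <= m l')%N, linked l r l' r',
    0 < s < 1,
     pt l r s =
     pt l' r' t
     & x = proj g (pt l r s)]) \/
  exists v, [/\ v \in ends l, v \in ends l' & x = pp (vp v)].
Proof.
move=> ll [r /= rm xr] [r' /= rm' xr'].
have ne : (l, r) <> (l', r') by case=> e _; rewrite e eqxx in ll.
case: (meet rm rm' ne xr xr') => [[s [t [lk s01 _ e xE]]]|[i [j [hi hj e h]]]].
  by left; exists r, r', s, t.
right; have im : (i <= (m l).+1)%N by lia.
have jm : (j <= (m l').+1)%N by lia.
have [v e1 e2] := nd_share ll im jm e.
exists v; split; [exact: (nd_vertex im e1).1|exact: (nd_vertex jm e2).1|].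
by apply: h; rewrite ?(cs_vertex CS).
Qed.

(** The closed set that the crossing chart around a point of chord [r] has to avoid. *)
Let rest l r : set (R * R) :=
  \bigcup_(r' in [set r' | (r' <= m l)%N /\ r' <> r])
    segment g (par (st l r')) (par (en l r')).

Let closed_rest l r : closed (rest l r).
Proof.
apply: closed_bigcup => [|r' _]; last exact: closed_segment.
by apply: (@sub_finite_set _ _ `I_(m l).+1) => [r' [] //|]; exact: finite_II.
Qed.

Let rest_disc l r : rest l r `<=` [set z | sqn z <= 1].
Proof. by move=> z [r' _]; exact: segment_disc. Qed.

Let tr_split l r : (r <= m l)%N -> tr l = ch l r `|` proj g @` rest l r.
Proof.
move=> rm; apply/seteqP; split=> [x [r' /= rm' hx]|x [hx|[z [r' [rm' _] hz]
  <-]]].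
- have [<-|/eqP ne] := eqVneq r' r; [by left|right].
  by case: hx => z hz <-; exists z => //; exists r'.
- by exists r.
- by exists r' => //; exists z.
Qed.

(** The point is inside the disc, hence no node, and [cs_self] forbids a crossing with another chord
    of the same edge. *)
Let not_rest l r s : (r <= m l)%N -> 0 < s < 1 ->
  ~ rest l r (pt l r s).
Proof.
move=> rm s01 [r' [rm' ne] hz].
have [dst den] : (0 <= par (st l r) < 2 * g%:R) /\ (0 <= par (en l r) < 2 *
  g%:R).
  by split; apply: pos_param_dom => //; [exact: va|exact: vb].
have x1 : ch l r (proj g (pt l r s)).
  exists (pt l r s) => //.
  by exists s => //=; rewrite in_itv /=; move: s01 => /andP[/ltW -> /ltW ->].
have x2 : ch l r' (proj g (pt l r s)).
  by exists (pt l r s).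
have self i j : (i <= m l)%N -> (j <= m l)%N -> i <> j -> ~~ linked l i l j.
  have sym : linked l i l j = linked l j l i.
    rewrite /linked /interlaced /alternate.
    by apply/idP/idP; case/or4P => /orP[] ->; rewrite ?orbT.
  move=> im jm ij; case: (ltngtP i j) => // h; [|rewrite sym];
    by apply: (cs_self CS); lia.
case: (meet rm rm' _ x1 x2) => [[] //|[s' [t [lk _ _ _ _]]]|[i [j [hi hj e
  h]]]].
  by case=> e; apply: ne.
  by have := self r r' rm rm' (not_eq_sym ne); rewrite lk.
have {}h : exists p, proj g (pt l r s) = proj g (B p).
  case: hi => e'; [exists (par (st l r)); apply: (h (st l r));
    rewrite ?va// nd_st// e' //
    |exists (par (en l r)); apply: (h (en l r)); rewrite ?vb// e' //].
case: h => p e'.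
have s1 := sqn_point_on_lt1 g_gt0 s dst den (chord_neq rm).
have h : pt l r s = B p.
  by apply: (proj_inj_interior _ _ e'); rewrite ?s1// sqn_boundary.
by move: s1; rewrite h sqn_boundary ltxx s01.
Qed.

Theorem chord_system_thrackle (e : rel V) :
  (forall E, E \in edges e -> exists l, E = ends l) ->
  can_be_thrackled R e S.
Proof.
move=> He.
have /choice[f fP] : forall l, exists f : R -> S,
    [/\ continuous f, set_inj `[0, 1] f, f 0 = pp (vp (ep l).1),
      f 1 = pp (vp (ep l).2) & f @` `[0, 1] = tr l] by move=> l;
        exact: edge_arc.
(* Sets that are not edges get a constant map, about which [is_thrackle] says nothing. *)
pose arc (E : {set V}) : R -> S :=
  if [pick l | ends l == E] is Some l then f l else fun=> pp (0, 0).
have arcE l : arc (ends l) = f l.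
  rewrite /arc; case: pickP => [l' /eqP /(cs_ends_inj CS) -> //|/(_ l)].
  by rewrite eqxx.
have trE l : trace arc (ends l) = tr l.
  by rewrite /trace arcE; case: (fP l).
exists (pp \o vp), arc; split.
- split=> [v w /pp_eq /= h|E /He[l ->]].
    by apply: (@cs_vertex_inj CS); apply: h; exact: (cs_vertex CS).
  have [cf fi f0 f1 fA] := fP l; rewrite trE arcE; split=> //.
  + exact: continuous_subspaceT.
  + by exists (ep l).1, (ep l).2.
  + by move=> v; exact: vertex_on.
- move=> E F v /He[l ->] /He[l' ->] EF; rewrite !trE.
  have vv : v \in ends l :&: ends l' by rewrite EF inE.
  have /andP[vl vl'] : (v \in ends l) && (v \in ends l') by rewrite
    -finset.in_setI.
  have ll : l != l'.
    apply/eqP => ll; have := cs_ends CS l; move: EF;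
      rewrite -ll finset.setIid => EF.
    have h1 : (ep l).1 \in ends l by rewrite !inE eqxx.
    have h2 : (ep l).2 \in ends l by rewrite !inE eqxx orbT.
    by move: h1 h2; rewrite EF !inE => /eqP -> /eqP ->; rewrite eqxx.
  apply/seteqP; split=> [x [x1 x2]|_ ->] /=; last by split; exact: on_vertex.
  case: (meet_edges ll x1 x2) => [[r [r' [s [t [[rm rm'] lk _ _ _]]]]]|[w [w1
    w2 ->]]].
    have h0 : ends l :&: ends l' != finset.set0 by apply/finset.set0Pn;
      exists v.
    by have := cs_adjacent CS ll h0 rm rm'; rewrite lk.
  by have : w \in ends l :&: ends l' by [rewrite finset.in_setI w1 w2];
    rewrite EF inE => /eqP ->.
- move=> E F /He[l ->] /He[l' ->] EF; rewrite !trE.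
  have ll : l != l'.
    apply/eqP => ll; have : (ep l).1 \in ends l :&: ends l' by rewrite -ll
      !inE eqxx.
    by rewrite EF inE.
  have [r [r' [rm rm' lk uniq_rr]]] := cs_cross CS EF.
  have dom p : valid_pos g M p -> 0 <= par p < 2 * g%:R by exact: pos_param_dom.
  move: (lk); rewrite /linked -(interlaced_param R M_gt0 (va rm) (vb rm) (va
    rm') (vb rm')) => il.
  have [il1 il2] := chords_cross g_gt0 (dom _ (va rm)) (dom _ (vb rm)) (dom _
    (va rm')) (dom _ (vb rm')) il.
  have [s [t [s01 t01 e0]]] := point_on_cross il1 il2.
  exists (proj g (pt l r s)).
    apply/seteqP; split=> [x [x1 x2]|_ ->] /=.
      case: (meet_edges ll x1 x2) => [[k [k' [s' [t' [[km km'] lk' s01' e'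
        ->]]]]]|[w [w1 w2 _]]].
        have [kr kr'] := uniq_rr _ _ km km' lk'; rewrite kr kr' in e' *.
        (* Both parameters are zeros of the same affine function along chord [r]. *)
        suff -> : s' = s by [].
        apply: (orient_point_on_inj il2);
          first by rewrite e' orient_point_on_self.
        by rewrite e0 orient_point_on_self.
      by have : w \in ends l :&: ends l' by [rewrite finset.in_setI w1 w2];
        rewrite EF inE.
    split.
      exists r => //; exists (pt l r s) => //.
      by exists s => //=; rewrite in_itv /=;
        move: s01 => /andP[/ltW -> /ltW ->].
    exists r' => //; exists (pt l r s) => //.
    by rewrite e0; exists t => //=; rewrite in_itv /=;
      move: t01 => /andP[/ltW -> /ltW ->].
  rewrite (tr_split rm) (tr_split rm').
  apply: (chord_crosses g_gt0 (dom _ (va rm)) (dom _ (vb rm)) (dom _ (va rm'))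
    (dom _ (vb rm')) il s01 e0).
  + exact: closed_rest.
  + exact: closed_rest.
  + exact: rest_disc.
  + exact: rest_disc.
  + exact: not_rest.
  + by rewrite e0; exact: not_rest.
Qed.

End ChordSystem.

Definition share (p q : nat * nat) : bool :=
  [|| p.1 == q.1, p.1 == q.2, p.2 == q.1 | p.2 == q.2].

(* A chord system whose vertices are the numbers 0, ..., n, vertex 0 being
   joined to all others.  [X l l'] are the indices of the chords in which the
   edges l and l' cross if they are not adjacent. *)
Section NumberedSystem.
Variables (g M n : nat) (L : finType) (ep : L -> nat * nat).
Variables (vp : nat -> nat * nat) (m : L -> nat) (st en : L -> nat -> nat *
  nat).
Variables (before : rel L) (X : L -> L -> nat * nat).
Local Notation cls := pos_class.
Local Notation linked := (linked st en).
Local Open Scope nat_scope.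

(** [before] lets each pair of edges be examined in one order only. [ns_linked] and [ns_cross]
    together say that nonadjacent edges are linked exactly at the chords given by [X], and adjacent
    ones nowhere. *)
Record numbered_system : Prop := NumberedSystem {
  ns_ends : forall l, (ep l).2 < (ep l).1 <= n;
  ns_inj : injective ep;
  ns_spoke : forall v, 0 < v <= n -> exists l, ep l = (v, 0);
  ns_vertex : forall v, v <= n -> valid_pos g M (vp v);
  ns_vertex_inj : forall v w, v <= n -> w <= n -> cls (vp v) = cls (vp w) ->
    v = w;
  ns_valid : forall l r, r <= m l ->
    valid_pos g M (st l r) && valid_pos g M (en l r);
  ns_glue : forall l r, r < m l -> cls (st l r.+1) = cls (en l r);
  ns_start : forall l, cls (st l 0) = cls (vp (ep l).1);
  ns_stop : forall l, cls (en l (m l)) = cls (vp (ep l).2);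
  ns_inner : forall l r v, r < m l -> v <= n -> cls (en l r) != cls (vp v);
  ns_inner_inj : forall l r l' r', r < m l -> r' < m l' ->
    (l == l') || before l l' -> cls (en l r) = cls (en l' r') -> l = l' /\ r =
      r';
  ns_total : forall l l', l != l' -> before l l' || before l' l;
  ns_self : forall l r r', r <= m l -> r' <= m l -> ~~ linked l r l r';
  ns_linked : forall l l' r r', before l l' -> r <= m l -> r' <= m l' ->
    linked l r l' r' -> ~~ share (ep l) (ep l') /\ (r, r') = X l l';
  ns_cross : forall l l', before l l' -> ~~ share (ep l) (ep l') ->
    [/\ (X l l').1 <= m l, (X l l').2 <= m l'
      & linked l (X l l').1 l' (X l l').2] }.

Hypothesis NS : numbered_system.

Let vertex_end l : 'I_n.+1 * 'I_n.+1 := (inord (ep l).1, inord (ep l).2).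

Let vertex_endE l :
  (((vertex_end l).1 : nat) = (ep l).1) * (((vertex_end l).2 : nat) = (ep l).2).
Proof. by have := ns_ends NS l => h; split; rewrite inordK //; lia. Qed.

Let ends := (@ends _ _ vertex_end).

(** The larger end comes first in [ep], so the set of ends determines the pair. *)
Let ends_inj : injective ends.
Proof.
move=> l l' E; apply: (ns_inj NS).
have h := ns_ends NS l; have h' := ns_ends NS l'.
have [e1 e2] := vertex_endE l; have [e1' e2'] := vertex_endE l'.
have H k k' : ends k = ends k' -> ((ep k).1 == (ep k').1) || ((ep k).1 == (ep
  k').2).
  move=> ek; have := (vertex_endE k, vertex_endE k') => -[[a1 a2] [b1 b2]].
  rewrite -a1 -b1 -b2 !val_eqE; have : (vertex_end k).1 \in ends k' by rewrite
    -ek !inE eqxx.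
  by rewrite !inE.
have H2 k k' : ends k = ends k' -> ((ep k).2 == (ep k').1) || ((ep k).2 == (ep
  k').2).
  move=> ek; have := (vertex_endE k, vertex_endE k') => -[[a1 a2] [b1 b2]].
  rewrite -a2 -b1 -b2 !val_eqE; have : (vertex_end k).2 \in ends k' by rewrite
    -ek !inE eqxx orbT.
  by rewrite !inE.
have := H _ _ E; have := H2 _ _ E; have := H _ _ (esym E);
  have := H2 _ _ (esym E).
rewrite (surjective_pairing (ep l)) (surjective_pairing (ep l')) /=.
by move=> *; congr pair; lia.
Qed.

Let ends_meet l l' : (ends l :&: ends l' != finset.set0)%SET = share (ep l)
  (ep l').
Proof.
have [e1 e2] := vertex_endE l; have [e1' e2'] := vertex_endE l'.
rewrite /share -e1 -e2 -e1' -e2' !val_eqE.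
apply/finset.set0Pn/or4P => [[v]|].
  rewrite !inE => /andP[/orP[]/eqP -> /orP[]/eqP ->]; rewrite eqxx.
  - by constructor 1.
  - by constructor 2.
  - by constructor 3.
  - by constructor 4.
case=> /eqP e.
- by exists (vertex_end l).1; rewrite !inE e eqxx ?orbT.
- by exists (vertex_end l).1; rewrite !inE e eqxx ?orbT.
- by exists (vertex_end l).2; rewrite !inE e eqxx ?orbT.
- by exists (vertex_end l).2; rewrite !inE e eqxx ?orbT.
Qed.

Let linkedC l r l' r' : linked l r l' r' = linked l' r' l r.
Proof.
rewrite /linked /interlaced /alternate.
by apply/idP/idP; case/or4P => /orP[] ->; rewrite ?orbT.
Qed.

Let numbered_chord_system :
  chord_system g M vertex_end (fun v : 'I_n.+1 => vp v) m st en.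
Proof.
have ltn (v : 'I_n.+1) : v <= n by rewrite -ltnS.
split.
- move=> l; rewrite -val_eqE /= -/(vertex_end l).1.
  by rewrite !vertex_endE; have := ns_ends NS l; lia.
- exact: ends_inj.
- by move=> v; apply: (ns_vertex NS).
- by move=> v w /= /(ns_vertex_inj NS (ltn v) (ltn w)) /val_inj.
- exact: (ns_valid NS).
- exact: (ns_glue NS).
- by move=> l; rewrite vertex_endE (ns_start NS).
- by move=> l; rewrite vertex_endE (ns_stop NS).
- by move=> l r v rm; apply: (ns_inner NS).
- move=> l r l' r' rm rm' e.
  have [ll|ll] := boolP ((l == l') || before l l').
    exact: (ns_inner_inj NS rm rm' ll e).
  have ll' : (l' == l) || before l' l.
    move: ll; rewrite negb_or => /andP[ne nb].
    by have := ns_total NS ne; rewrite (negbTE nb) /= => ->; rewrite orbT.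
  by have [-> ->] := ns_inner_inj NS rm' rm ll' (esym e).
- by move=> l r r' /andP[rr rm]; apply: (ns_self NS) => //; lia.
- move=> l l' r r' ll; rewrite ends_meet => sh rm rm'.
  apply/negP => lk; case/orP: (ns_total NS ll) => b.
    by have [] := ns_linked NS b rm rm' lk; rewrite sh.
  rewrite linkedC in lk; have [] := ns_linked NS b rm' rm lk.
  suff -> : share (ep l') (ep l) by [].
  by rewrite -ends_meet finset.setIC ends_meet.
- move=> l l' E.
  have sh : ~~ share (ep l) (ep l') by rewrite -ends_meet negbK E.
  have sh' : ~~ share (ep l') (ep l) by rewrite -ends_meet negbK finset.setIC E.
  have ll : l != l'.
    by apply: contra sh => /eqP ->; rewrite /share eqxx.
  case/orP: (ns_total NS ll) => b.
    have [x1 x2 lk] := ns_cross NS b sh.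
    exists (X l l').1, (X l l').2; split=> // s s' sm sm' lk'.
    by have [_ <-] := ns_linked NS b sm sm' lk'.
  have [x1 x2 lk] := ns_cross NS b sh'.
  exists (X l' l).2, (X l' l).1; split=> //; first by rewrite linkedC.
  move=> s s' sm sm'; rewrite linkedC => lk'.
  by have [_ <-] := ns_linked NS b sm' sm lk'.
Qed.

Let adj : rel 'I_n.+1 := fun x y =>
  [exists l, (ep l == (x : nat, y : nat)) || (ep l == (y : nat, x : nat))].

Let edgesE : edges adj = [set ends l | l : L]%SET.
Proof.
apply/setP => E; rewrite inE; apply/existsP/imsetP =>
  [[x /existsP[y]]|[l _ ->]].
  case/andP => /existsP[l hl] /eqP ->; exists l => //.
  have [e1 e2] := vertex_endE l.
  case/orP: hl => /eqP hl; rewrite hl /= in e1 e2.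
    have -> : x = (vertex_end l).1 by apply: val_inj.
    by have -> : y = (vertex_end l).2 by apply: val_inj.
  have -> : y = (vertex_end l).1 by apply: val_inj.
  have -> : x = (vertex_end l).2 by apply: val_inj.
  by rewrite finset.setUC.
exists (vertex_end l).1; apply/existsP; exists (vertex_end l).2.
rewrite eqxx andbT; apply/existsP; exists l.
by rewrite !vertex_endE -surjective_pairing eqxx.
Qed.

Theorem numbered_system_thrackle (R : realType) : 0 < g -> 0 < M ->
  exists e : rel 'I_n.+1,
    [/\ simple_graph e, connected_graph e, #|edges e| = #|L|
      & can_be_thrackled R e (nonorientable_surface R g)].
Proof.
move=> g0 M0; exists adj; split.
- split=> [x y|x].
    by apply/existsP/existsP => -[l h]; exists l; rewrite orbC.
  apply/existsP => -[l]; rewrite orbb => /eqP e.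
  by have := ns_ends NS l; rewrite e /=; lia.
- split; first by rewrite card_ord.
  have H x : connect adj x ord0.
    have [->|x0] := eqVneq x ord0; first exact: connect0.
    have [l e] := ns_spoke NS (v := x) ltac:(by rewrite lt0n x0 -ltnS ltn_ord).
    by apply: connect1; apply/existsP; exists l; rewrite e eqxx.
  have adjC : symmetric adj.
    by move=> u v; apply/existsP/existsP => -[l h]; exists l; rewrite orbC.
  move=> x y; apply: connect_trans (H x) _.
  by rewrite (sym_connect_sym adjC); exact: H.
- by rewrite edgesE card_imset.
- have := @chord_system_thrackle g M _ _ vertex_end (fun v : 'I_n.+1 =>
    vp v) m st en
    R g0 M0 numbered_chord_system adj.
  apply=> E.
  by rewrite edgesE => /imsetP[l _ ->]; exists l.
Qed.

End NumberedSystem.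

(** * Gluing and interlacing as arithmetic on sides and offsets *)

Section LexicographicPositions.
Local Open Scope nat_scope.
Implicit Types p q : nat * nat.

Lemma pos_class_eq p q : pos_class p = pos_class q <->
  p.2 = 0 /\ q.2 = 0 \/ p.2 <> 0 /\ p.2 = q.2 /\ p.1./2 = q.1./2.
Proof.
rewrite /pos_class; case: (eqVneq p.2 0) => p0; case: (eqVneq q.2 0) => q0.
- by split=> // _; left.
- by split=> [[_ /esym q00]|]; [rewrite q00 in q0|lia].
- by split=> [[_ p00]|]; [rewrite p00 in p0|lia].
- by split=> [[-> ->]|]; [right; split=> //; apply/eqP|case;
    [lia|case=> _ [-> ->]]].
Qed.

Lemma interlacedC1 p q p' q' :
  interlaced pos_lt p q p' q' = interlaced pos_lt q p p' q'.
Proof.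
by rewrite /interlaced; apply/idP/idP; case/or4P => ->; rewrite ?orbT.
Qed.

Lemma interlacedC2 p q p' q' :
  interlaced pos_lt p q p' q' = interlaced pos_lt p q q' p'.
Proof.
by rewrite /interlaced; apply/idP/idP; case/or4P => ->; rewrite ?orbT.
Qed.

(** By transitivity, each of the other three alternatives would put the ends of one chord in the
    wrong order. *)
Lemma interlaced_sorted p q p' q' : ~~ pos_lt q p -> ~~ pos_lt q' p' ->
  interlaced pos_lt p q p' q' = alternate pos_lt p q p' q'.
Proof.
have tr x y z : pos_lt x y -> pos_lt y z -> pos_lt x z.
  by rewrite /pos_lt; lia.
move=> n1 n2; rewrite /interlaced /alternate.
apply/idP/idP => [|->//]; case/or4P => //; case/orP => /and3P[h1 h2 h3];
  by move: n1 n2; rewrite ?(tr _ _ _ h1 h2) ?(tr _ _ _ h2 h3).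
Qed.

End LexicographicPositions.

(* Orienting both chords turns [interlaced] into the four times shorter
   [alternate], for the sake of [lia]. *)
Ltac sort_chords :=
  match goal with |- context [interlaced pos_lt ?p ?q ?p' ?q'] =>
    first [have -> : interlaced pos_lt p q p' q' = interlaced pos_lt q p p' q'
      :=
             @interlacedC1 p q p' q';
           have : ~~ pos_lt p q by rewrite /pos_lt /=; lia
          |have : ~~ pos_lt q p by rewrite /pos_lt /=; lia];
    first [have -> : interlaced pos_lt _ _ p' q' = interlaced pos_lt _ _ q' p'
      :=
             @interlacedC2 _ _ p' q';
           have : ~~ pos_lt p' q' by rewrite /pos_lt /=; lia
          |have : ~~ pos_lt q' p' by rewrite /pos_lt /=; lia];
    let h1 := fresh in let h2 := fresh in
    move=> h2 h1; rewrite (interlaced_sorted h1 h2); clear h1 h2 end.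

(** Impossible shapes are discarded after each case split, and the common part [2 * K] of two side
    numbers is cancelled, so that [lia] is left with little more than the offsets. *)
Ltac chord_cases :=
  let sp := fresh in let sq := fresh in
  move=> sp sq; destruct sq; try (exfalso; lia); destruct sp;
  try (exfalso; lia); sort_chords;
  rewrite /alternate /pos_lt /= ?(ltn_add2l, eqn_add2l, ltnn, eqxx)
    ?(andbF, orbF, andbT) /=.

Ltac class_cases :=
  let sp := fresh in let sq := fresh in
  move=> sp sq; destruct sq; try (exfalso; lia); destruct sp;
  try (exfalso; lia); rewrite pos_class_eq /=.

(** * The fan on the projective plane *)

Section Fan.
Variable n : nat.
Local Open Scope nat_scope.
(** Vertices and spokes use the offsets up to [n] and from [T - n] on; the steps use those from
    [n + 1] to [3 * n], in between. *)
Let T := 4 * n + 10.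

Definition fan_pos (l : nat) : nat * nat :=
  if l == 0 then (0, 0) else if odd l then (0, l) else (0, T - l).

(** Increasing on each parity, so that two steps of the same parity cross in one of their chords and
    are nested in the other; the even levels lie below the odd ones. *)
Let level l := if odd l then 2 * n + l else n + l.

(** The first chords join the offsets [l] and [T - l] of side 0 and are nested, deeper for larger
    [l]; the second ones run along side 1 to the nearer of its two corners. *)
Definition spoke_start (l r : nat) : nat * nat :=
  if r == 0 then fan_pos l else (1, if odd l then T - l else l).
Definition spoke_stop (l r : nat) : nat * nat :=
  if r == 0 then (0, if odd l then T - l else l) else (~~ odd l : nat, 0).
Definition step_start (l r : nat) : nat * nat :=
  if r == 0 then fan_pos l.+1 else (1, level l).
Definition step_stop (l r : nat) : nat * nat :=
  if r == 0 then (0, level l) else fan_pos l.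

Variant fan_vertex (v : nat) : nat * nat -> Prop :=
| FanApex of v = 0 : fan_vertex v (0, 0)
| FanOdd of odd v : fan_vertex v (0, v)
| FanEven t of ~~ odd v & 0 < v & t + v = T : fan_vertex v (0, t).

Variant fan_spoke (l : nat) : nat -> nat * nat -> nat * nat -> Prop :=
| FanSpokeOdd0 t of odd l & t + l = T : fan_spoke l 0 (0, l) (0, t)
| FanSpokeOdd1 t of odd l & t + l = T : fan_spoke l 1 (1, t) (0, 0)
| FanSpokeEven0 t of ~~ odd l & t + l = T : fan_spoke l 0 (0, t) (0, l)
| FanSpokeEven1 of ~~ odd l : fan_spoke l 1 (1, l) (1, 0).

Variant fan_step (l : nat) : nat -> nat * nat -> nat * nat -> Prop :=
| FanStepOdd0 t of odd l & t + l.+1 = T : fan_step l 0 (0, t) (0, 2 * n + l)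
| FanStepOdd1 of odd l : fan_step l 1 (1, 2 * n + l) (0, l)
| FanStepEven0 of ~~ odd l : fan_step l 0 (0, l.+1) (0, n + l)
| FanStepEven1 t of ~~ odd l & t + l = T : fan_step l 1 (1, n + l) (0, t).

Let fan_odd l : odd l -> fan_pos l = (0, l).
Proof. by move=> ol; rewrite /fan_pos ol ifF //; lia. Qed.

Let fan_even l : ~~ odd l -> 0 < l -> fan_pos l = (0, T - l).
Proof. by move=> ol l0; rewrite /fan_pos (negbTE ol) ifF //; lia. Qed.

Let fan_vertexP v : v <= n -> fan_vertex v (fan_pos v).
Proof.
move=> vn; have [->|v0] := posnP v; first exact: FanApex.
have [ov|ov] := boolP (odd v); first by rewrite fan_odd//; exact: FanOdd.
by rewrite fan_even//; apply: FanEven; lia.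
Qed.

Let fan_spokeP l r : 0 < l <= n -> r <= 1 ->
  fan_spoke l r (spoke_start l r) (spoke_stop l r).
Proof.
rewrite /spoke_start /spoke_stop => ln; case: r => [|[|//]] _ /=;
  have [ol|ol] := boolP (odd l).
- by rewrite fan_odd//; apply: FanSpokeOdd0; lia.
- by rewrite fan_even//; [apply: FanSpokeEven0; lia|lia].
- by apply: FanSpokeOdd1; lia.
- exact: FanSpokeEven1.
Qed.

Let fan_stepP l r : 0 < l < n -> r <= 1 ->
  fan_step l r (step_start l r) (step_stop l r).
Proof.
rewrite /step_start /step_stop /level => ln; case: r => [|[|//]] _ /=;
  have [ol|ol] := boolP (odd l).
- by rewrite fan_even//=; [apply: FanStepOdd0; lia|lia].
- by rewrite fan_odd//=; apply: FanStepEven0.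
- by rewrite fan_odd//; exact: FanStepOdd1.
- by rewrite fan_even//; [apply: FanStepEven1; lia|lia].
Qed.

Let spoke_linked l r j s : bool := interlaced pos_lt (spoke_start l r)
  (spoke_stop l r) (spoke_start j s) (spoke_stop j s).
Let mixed_linked l r j s : bool := interlaced pos_lt (spoke_start l r)
  (spoke_stop l r) (step_start j s) (step_stop j s).
Let step_linked l r j s : bool := interlaced pos_lt (step_start l r)
  (step_stop l r) (step_start j s) (step_stop j s).

Let spoke_unlinked l r j s : 0 < l <= n -> 0 < j <= n -> r <= 1 -> s <= 1 ->
  ~~ spoke_linked l r j s.
Proof.
rewrite /spoke_linked => vl vj r1 s1; move: (fan_spokeP vl r1).
have [<-|lj] := eqVneq l j.
  move: (fan_spokeP vl s1).
  move: (spoke_start _ _) (spoke_stop _ _) (spoke_start _ _) (spoke_stop _ _)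
    => p q p' q'.
  by chord_cases; lia.
move: (fan_spokeP vj s1).
move: (spoke_start _ _) (spoke_stop _ _) (spoke_start _ _) (spoke_stop _ _)
  => p q p' q'.
by chord_cases; lia.
Qed.

(** The step goes inward from depth [j + 1], crossing the deeper spokes, and returns from side 1 to
    depth [j], crossing the shallower ones. Only the two adjacent spokes are left out. *)
Let mixed_linkedP l r j s : 0 < l <= n -> 0 < j < n -> r <= 1 -> s <= 1 ->
  mixed_linked l r j s -> l != j /\ l != j.+1 /\ r = 0 /\ s = (l < j).
Proof.
rewrite /mixed_linked => vl vj r1 s1; move: (fan_spokeP vl r1) (fan_stepP vj
  s1).
move: (spoke_start _ _) (spoke_stop _ _) (step_start _ _) (step_stop _ _)
  => p q p' q'.
by chord_cases; lia.
Qed.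

Let mixed_cross l r j s : 0 < l <= n -> 0 < j < n -> r <= 1 -> s <= 1 ->
  l != j /\ l != j.+1 /\ r = 0 /\ s = (l < j) ->
  mixed_linked l r j s.
Proof.
rewrite /mixed_linked => vl vj r1 s1 cond;
  move: (fan_spokeP vl r1) (fan_stepP vj s1).
move: (spoke_start _ _) (spoke_stop _ _) (step_start _ _) (step_stop _ _)
  => p q p' q'.
by chord_cases; lia.
Qed.

Let step_linkedP l r j s : 0 < l < n -> 0 < j < n -> l < j -> r <= 1 -> s <= 1
  ->
  step_linked l r j s -> l.+1 != j /\ r = odd l && odd j /\ s = odd l || odd j.
Proof.
rewrite /step_linked => vl vj lj r1 s1; move: (fan_stepP vl r1) (fan_stepP vj
  s1).
move: (step_start _ _) (step_stop _ _) (step_start _ _) (step_stop _ _)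
  => p q p' q'.
by chord_cases; lia.
Qed.

Let step_cross l r j s : 0 < l < n -> 0 < j < n -> l < j -> r <= 1 -> s <= 1 ->
  l.+1 != j /\ r = odd l && odd j /\ s = odd l || odd j ->
  step_linked l r j s.
Proof.
rewrite /step_linked => vl vj lj r1 s1 cond;
  move: (fan_stepP vl r1) (fan_stepP vj s1).
move: (step_start _ _) (step_stop _ _) (step_start _ _) (step_stop _ _)
  => p q p' q'.
by chord_cases; lia.
Qed.

Let step_unlinked l r s : 0 < l < n -> r <= 1 -> s <= 1 ->
  ~~ step_linked l r l s.
Proof.
rewrite /step_linked => vl r1 s1; move: (fan_stepP vl r1) (fan_stepP vl s1).
move: (step_start _ _) (step_stop _ _) (step_start _ _) (step_stop _ _)
  => p q p' q'.
by chord_cases; lia.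
Qed.

Let spoke_spoke_inner l r j s : 0 < l <= n -> 0 < j <= n -> r < 1 -> s < 1 ->
  pos_class (spoke_stop l r) = pos_class (spoke_stop j s) -> l = j.
Proof.
move=> vl vj r1 s1; move: (fan_spokeP vl (ltnW r1)) (fan_spokeP vj (ltnW s1)).
move: (spoke_start _ _) (spoke_stop _ _) (spoke_start _ _) (spoke_stop _ _) =>
  p q p' q'.
by class_cases; lia.
Qed.

Let spoke_step_inner l r j s : 0 < l <= n -> 0 < j < n -> r < 1 -> s < 1 ->
  pos_class (spoke_stop l r) = pos_class (step_stop j s) -> False.
Proof.
move=> vl vj r1 s1; move: (fan_spokeP vl (ltnW r1)) (fan_stepP vj (ltnW s1)).
move: (spoke_start _ _) (spoke_stop _ _) (step_start _ _) (step_stop _ _) =>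
  p q p' q'.
by class_cases; lia.
Qed.

Let step_step_inner l r j s : 0 < l < n -> 0 < j < n -> r < 1 -> s < 1 ->
  pos_class (step_stop l r) = pos_class (step_stop j s) -> l = j.
Proof.
move=> vl vj r1 s1; move: (fan_stepP vl (ltnW r1)) (fan_stepP vj (ltnW s1)).
move: (step_start _ _) (step_stop _ _) (step_start _ _) (step_stop _ _) =>
  p q p' q'.
by class_cases; lia.
Qed.

Let spoke_vertex_inner l r v : 0 < l <= n -> r < 1 -> v <= n ->
  pos_class (spoke_stop l r) <> pos_class (fan_pos v).
Proof.
move=> vl r1 vn; move: (fan_spokeP vl (ltnW r1)) (fan_vertexP vn).
by move: (spoke_start _ _) (spoke_stop _ _) (fan_pos _) => p q z; class_cases;
  lia.
Qed.

Let step_vertex_inner l r v : 0 < l < n -> r < 1 -> v <= n ->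
  pos_class (step_stop l r) <> pos_class (fan_pos v).
Proof.
move=> vl r1 vn; move: (fan_stepP vl (ltnW r1)) (fan_vertexP vn).
by move: (step_start _ _) (step_stop _ _) (fan_pos _) => p q z; class_cases;
  lia.
Qed.

Let L : finType := ('I_n + 'I_n.-1)%type.

Let fan_ends (x : L) : nat * nat :=
  match x with inl i => (i.+1, 0) | inr i => (i.+2, i.+1) end.

Let fan_start (x : L) : nat -> nat * nat :=
  match x with inl i => spoke_start i.+1 | inr i => step_start i.+1 end.

Let fan_stop (x : L) : nat -> nat * nat :=
  match x with inl i => spoke_stop i.+1 | inr i => step_stop i.+1 end.

Let fan_before (x y : L) : bool :=
  match x, y with
  | inl i, inl j => i < j
  | inr i, inr j => i < j
  | inl _, inr _ => true
  | _, _ => false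
  end.

Let fan_crossing (x y : L) : nat * nat :=
  match x, y with
  | inl i, inr j => (0, i < j : nat)
  | inr i, inr j => (~~ odd i && ~~ odd j : nat, ~~ odd i || ~~ odd j : nat)
  | _, _ => (0, 0)
  end.

Lemma fan_system : numbered_system 1 T n fan_ends fan_pos (fun=> 1)
  fan_start fan_stop fan_before fan_crossing.
Proof.
have spoke (i : 'I_n) : 0 < i.+1 <= n by have := ltn_ord i; lia.
have step (i : 'I_n.-1) : 0 < i.+1 < n by have := ltn_ord i; lia.
split.
- by case=> i /=; [have := spoke i|have := step i]; lia.
- move=> [i|i] [j|j] /= e; case: e => *; try (exfalso; lia);
    by [congr inl; apply: val_inj|congr inr; apply: val_inj].
- move=> v /andP[v0 vn]; have vn' : v.-1 < n by lia.
  by exists (inl (Ordinal vn')) => /=; rewrite prednK.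
- by move=> v vn; case: (fan_vertexP vn) => *; rewrite /valid_pos /=; lia.
- move=> v w vn wn; move: (fan_vertexP vn) (fan_vertexP wn).
  by move: (fan_pos _) (fan_pos _) => p q; class_cases; lia.
- move=> [i|i] r r1; rewrite /fan_start /fan_stop /valid_pos.
    by have := spoke i; case: (fan_spokeP (spoke i) r1) => *; rewrite /=; lia.
  by have := step i; case: (fan_stepP (step i) r1) => *; rewrite /=; lia.
- by move=> [i|i] [|//] _; rewrite /pos_class /=.
- by case.
- by move=> [i|i]; rewrite /pos_class /=.
- move=> [i|i] r v r1 vn; apply/eqP.
    exact: spoke_vertex_inner (spoke i) r1 vn.
  exact: step_vertex_inner (step i) r1 vn.
- move=> [i|i] r [j|j] s r1 s1 b e; try by [].
  + have [ij] := spoke_spoke_inner (spoke i) (spoke j) r1 s1 e.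
    by split; [congr inl; apply: val_inj|lia].
  + by have := spoke_step_inner (spoke i) (step j) r1 s1 e.
  + have [ij] := step_step_inner (step i) (step j) r1 s1 e.
    by split; [congr inr; apply: val_inj|lia].
- by move=> [i|i] [j|j] //= ij; rewrite -neq_ltn;
    apply: contra ij => /eqP/val_inj ->.
- move=> [i|i] r s r1 s1; first exact: spoke_unlinked.
  exact: step_unlinked.
- move=> [i|i] [j|j] r s //= b r1 s1 lk.
  + by have /negP[] := spoke_unlinked (spoke i) (spoke j) r1 s1.
  + have [h1 [h2 [-> ->]]] := mixed_linkedP (spoke i) (step j) r1 s1 lk.
    by split=> //; rewrite /share /=; lia.
  + have [h [-> ->]] := step_linkedP (step i) (step j) b r1 s1 lk.
    by split=> //; rewrite /share /=; lia.
- move=> [i|i] [j|j] //= b; rewrite /share /= => sh;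
    first by rewrite !orbT in sh.
  + split=> //; first by case: (_ < _).
    by apply: mixed_cross (spoke i) (step j) _ _ _ => //; [case: (_ < _)|lia].
  + split; [by case: (_ && _)|by case: (_ || _)|].
    by apply: step_cross (step i) (step j) b _ _ _;
      [case: (_ && _)|case: (_ || _)|rewrite /=; lia].
Qed.

Lemma fan_thrackle (R : realType) : exists e : rel 'I_n.+1,
  [/\ simple_graph e, connected_graph e, #|edges e| = n + n.-1
    & can_be_thrackled R e (nonorientable_surface R 1)].
Proof.
have T0 : 0 < T by rewrite /T; lia.
have [e [e1 e2 e3 e4]] := numbered_system_thrackle fan_system R isT T0.
by exists e; split=> //; rewrite e3 card_sum !card_ord.
Qed.

End Fan.

(** * The family *)

(* Vertex 0 is the apex and vertex l > 0 is x_l.  [Spoke l] joins x_l to the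
   apex, [Step l] joins x_(l+1) to x_l, [Skip k] joins x_(V-2k+2) to x_(V-2k) if
   k > 0, and [Skip 0] joins x_3 to x_1. *)
Variant label := Spoke of nat | Step of nat | Skip of nat.

Section Family.
Variables (K w : nat).
Local Open Scope nat_scope.
(** Odd, so that every skip joins two vertices of odd index and the spoke between them has even
    index. *)
Let V := w.*2.+1.
(** The offset of [x_1]. [Skip k] passes the same pair of sides at [2 * V + k + 1] and
    [2 * V + 2 * K + 3 - k], which are symmetric about [U]. *)
Let U := 2 * V + K + 2.
(** Large enough for the offsets from [T - V] on to exceed all those used by steps and skips between
    vertices. *)
Let T := 4 * V + 3 * K + 10.

(* Sides 2j - 2 and 2j - 1 are those of gate j, 1 <= j <= K; the crosscap with
   sides 2K + 2 and 2K + 3 serves the odd spokes and the steps, the one with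
   sides 2K and 2K + 1 the even spokes from 4 on and the skips. *)
Definition vertex_pos (l : nat) : nat * nat :=
  if l == 0 then (0, 0) else if l == 1 then (2 * K + 3, U)
  else if odd l then (2 * K + 1, l) else (2 * K + 2, T - l).

Definition label_ends (x : label) : nat * nat :=
  match x with
  | Spoke l => (l, 0)
  | Step l => (l.+1, l)
  | Skip k => if k == 0 then (3, 1) else (V - 2 * k + 2, V - 2 * k)
  end.

Definition valid_label (x : label) : bool :=
  match x with
  | Spoke l => 0 < l <= V
  | Step l => 0 < l < V
  | Skip k => k <= K
  end.

(* The corner at which an even spoke ends: if V - l = 2k - 1, this is the middle
   corner of gate k, so that [Skip k] can cross the spoke when it turns. *)
Let target l := if V < l + 2 * K then V - l else 2 * K.
Let level l := if odd l then V + l else l.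
(** Even, so that the passages before and after the turn both have offset [k], below the middle
    [K + 1]; at the opposite offset the turn would cross the spoke of [x_2]. *)
Let upward k := if odd k then k.-1 else k.
(* [Skip k] goes up through gates 1, ..., [upward k] and down through the
   gates from k or k - 1 to 1; its q-th passage has offset [strand k q], on
   either side of the middle K + 1 alternately. *)
Let strand k q := if odd q == (q <= upward k) then 2 * K.+1 - k else k.

(** There are [2 * k - 1] passages for either parity of [k]; on the way down, passage [q] uses gate
    [2 * k - q]. *)
Let gate_in k q : nat * nat :=
  if q <= upward k then (2 * q - 2, strand k q)
  else (2 * (2 * k - q) - 1, strand k q).
Let gate_out k q : nat * nat :=
  if q <= upward k then (2 * q - 1, strand k q)
  else (2 * (2 * k - q) - 2, strand k q).

(** The index of the last chord. [Step 1] is a single chord because it ends at the position glued to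
    that of [x_1]. *)
Definition chord_count (x : label) : nat :=
  match x with
  | Spoke l => if l == 2 then K else 1
  | Step l => if l == 1 then 0 else 1
  | Skip k => if k == 0 then 1 else 2 * k + 2
  end.

(** After the gates, [Skip k] has three more chords: one leads from gate 1 to the crosscap of the
    steps, one straddles offset [U] so as to cross [Step 1], and the last one reaches [x_(V-2k)]
    from outside, across the shallower spokes. *)
Definition chord_start (x : label) (r : nat) : nat * nat :=
  match x with
  | Spoke l =>
      if r == 0 then vertex_pos l else if l == 2 then (2 * r - 1, K.+1)
      else if odd l then (2 * K + 3, T - l) else (2 * K, l)
  | Step l =>
      if r == 0 then vertex_pos l.+1 else (2 * K + 3, level l)
  | Skip k =>
      if k == 0 then if r == 0 then vertex_pos 3 else (2 * K, V + K.+1)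
      else if r == 0 then vertex_pos (V - 2 * k + 2)
      else if r == 1 then (2 * K, V + k)
      else if r <= 2 * k then gate_out k r.-1
      else if r == (2 * k).+1 then (2 * K + 2, 2 * V + 2 * K + 3 - k)
      else (2 * K + 3, 2 * V + k + 1)
  end.

Definition chord_stop (x : label) (r : nat) : nat * nat :=
  match x with
  | Spoke l =>
      if l == 2 then if r == K then (2 * K, 0) else (2 * r, K.+1)
      else if odd l then if r == 0 then (2 * K + 2, T - l) else (0, 0)
      else if r == 0 then (2 * K + 1, l) else (target l, 0)
  | Step l =>
      if l == 1 then (2 * K + 2, U)
      else if r == 0 then (2 * K + 2, level l) else vertex_pos l
  | Skip k =>
      if k == 0 then if r == 0 then (2 * K + 1, V + K.+1) else vertex_pos 1
      else if r == 0 then (2 * K + 1, V + k)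
      else if r < 2 * k then gate_in k r
      else if r == 2 * k then (2 * K + 3, 2 * V + 2 * K + 3 - k)
      else if r == (2 * k).+1 then (2 * K + 2, 2 * V + k + 1)
      else vertex_pos (V - 2 * k)
  end.

(* Positions are given by equations because [lia] is slow on subtraction. *)
Variant spoke_spec (l : nat) : nat -> nat * nat -> nat * nat -> Prop :=
| SpokeFirst t of l = 1 & t + l = T :
    spoke_spec l 0 (2 * K + 3, U) (2 * K + 2, t)
| SpokeOdd0 t of odd l & 1 < l & t + l = T :
    spoke_spec l 0 (2 * K + 1, l) (2 * K + 2, t)
| SpokeOdd1 t of odd l & t + l = T : spoke_spec l 1 (2 * K + 3, t) (0, 0)
| SpokeEven0 t of ~~ odd l & 2 < l & t + l = T :
    spoke_spec l 0 (2 * K + 2, t) (2 * K + 1, l)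
| SpokeMiddle s of ~~ odd l & 2 < l & V < l + 2 * K & s + l = V :
    spoke_spec l 1 (2 * K, l) (s, 0)
| SpokeCorner of ~~ odd l & 2 < l & l + 2 * K <= V :
    spoke_spec l 1 (2 * K, l) (2 * K, 0)
| JokerDirect t of l = 2 & K = 0 & t + l = T :
    spoke_spec l 0 (2 * K + 2, t) (2 * K, 0)
| JokerEnter t of l = 2 & 0 < K & t + l = T :
    spoke_spec l 0 (2 * K + 2, t) (0, K.+1)
| JokerGate r s of l = 2 & 0 < r < K & s.+1 = 2 * r :
    spoke_spec l r (s, K.+1) (2 * r, K.+1)
| JokerLeave r s of l = 2 & r = K & 0 < K & s.+1 = 2 * r :
    spoke_spec l r (s, K.+1) (2 * K, 0).

Variant step_spec (l : nat) : nat -> nat * nat -> nat * nat -> Prop :=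
| StepFirst t of l = 1 & t + 2 = T :
    step_spec l 0 (2 * K + 2, t) (2 * K + 2, U)
| StepEven0 of ~~ odd l : step_spec l 0 (2 * K + 1, l.+1) (2 * K + 2, l)
| StepEven1 t of ~~ odd l & t + l = T :
    step_spec l 1 (2 * K + 3, l) (2 * K + 2, t)
| StepOdd0 t of odd l & 1 < l & t + l.+1 = T :
    step_spec l 0 (2 * K + 2, t) (2 * K + 2, V + l)
| StepOdd1 of odd l & 1 < l : step_spec l 1 (2 * K + 3, V + l) (2 * K + 1, l).

Variant skip_spec (k : nat) : nat -> nat * nat -> nat * nat -> Prop :=
| SkipFirst0 of k = 0 : skip_spec k 0 (2 * K + 1, 3) (2 * K + 1, V + K.+1)
| SkipFirst1 of k = 0 : skip_spec k 1 (2 * K, V + K.+1) (2 * K + 3, U)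
| Skip0 x of 0 < k & x + 2 * k = V.+2 :
    skip_spec k 0 (2 * K + 1, x) (2 * K + 1, V + k)
| SkipTurn1 of k = 1 : skip_spec k 1 (2 * K, V + k) (1, 1)
| Skip1 o of 1 < k & o + k = 2 * K.+1 : skip_spec k 1 (2 * K, V + k) (0, o)
| SkipUp r s o o' of 1 < r <= upward k & 0 < k & s + 3 = 2 * r &
    o + o' = 2 * K.+1 & odd r /\ o' = k \/ ~~ odd r /\ o = k :
    skip_spec k r (s, o') (s.+1, o)
| SkipTurnEven r s s' of r = (upward k).+1 & upward k = k & 1 < k &
    s.+1 = 2 * k & s' + 3 = 2 * k : skip_spec k r (s, k) (s', k)
| SkipTurnOdd r s s' of r = (upward k).+1 & (upward k).+1 = k & 1 < k &
    s + 3 = 2 * k & s'.+1 = 2 * k : skip_spec k r (s, k) (s', k)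
| SkipDown r j s o o' of (upward k).+1 < r < 2 * k & 0 < k & j + r = 2 * k &
    s.+1 = 2 * j & o + o' = 2 * K.+1 & odd r /\ o = k \/ ~~ odd r /\ o' = k :
    skip_spec k r (s.+1, o') (s, o)
| SkipX0 r t of 0 < k & r = 2 * k & t + k = 2 * V + 2 * K + 3 :
    skip_spec k r (0, k) (2 * K + 3, t)
| SkipX1 r t of 0 < k & r = (2 * k).+1 & t + k = 2 * V + 2 * K + 3 :
    skip_spec k r (2 * K + 2, t) (2 * K + 2, 2 * V + k + 1)
| SkipX2 r x of 0 < k & r = 2 * k + 2 & x + 2 * k = V :
    skip_spec k r (2 * K + 3, 2 * V + k + 1) (2 * K + 1, x).

(** Gives [V - 2 * K >= 5], so the other skips share no vertex with [Skip 0]. *)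
Hypothesis w_ge : K + 2 <= w.

Let upward_bounds k : k <= (upward k).+1 /\ upward k <= k /\ ~~ odd (upward k).
Proof. by rewrite /upward; case: ifP; lia. Qed.

Let vertex_odd l : odd l -> 1 < l -> vertex_pos l = (2 * K + 1, l).
Proof.
move=> ol l1; rewrite /vertex_pos ol ifF; last lia.
by rewrite ifF //; lia.
Qed.

Let vertex_even l : ~~ odd l -> 0 < l -> vertex_pos l = (2 * K + 2, T - l).
Proof.
move=> ol l0; rewrite /vertex_pos (negbTE ol) ifF; last lia.
by rewrite ifF //; lia.
Qed.

Lemma spoke_specP l r : 0 < l <= V -> r <= chord_count (Spoke l) ->
  spoke_spec l r (chord_start (Spoke l) r) (chord_stop (Spoke l) r).
Proof.
move=> lV /=; have [->|l2] := eqVneq l 2 => rm.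
  case: ifPn rm => [/eqP -> _|r0 rm].
    rewrite vertex_even//; case: eqVneq => K0; first by apply: JokerDirect; lia.
    by apply: JokerEnter; lia.
  case: eqVneq => rK; last by apply: JokerGate; lia.
  by rewrite rK; apply: JokerLeave; lia.
have [l1|l1] := eqVneq l 1.
  by case: r rm => [|[|//]] _; rewrite l1 /=;
    [apply: SpokeFirst|apply: SpokeOdd1]; lia.
have [ol|ol] := boolP (odd l).
  case: r rm => [|[|//]] _ /=; last by apply: SpokeOdd1; lia.
  by rewrite vertex_odd//; [apply: SpokeOdd0; lia|lia].
case: r rm => [|[|//]] _ /=.
  by rewrite vertex_even//; [apply: SpokeEven0; lia|lia].
rewrite /target; case: ifP => h; last by apply: SpokeCorner; lia.
by apply: SpokeMiddle; lia.
Qed.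

Lemma step_specP l r : 0 < l < V -> r <= chord_count (Step l) ->
  step_spec l r (chord_start (Step l) r) (chord_stop (Step l) r).
Proof.
move=> lV /=; have [->|l1] := eqVneq l 1 => rm.
  by case: r rm => // _; apply: StepFirst; lia.
rewrite /level; have [ol|ol] := boolP (odd l).
  case: r rm => [|[|//]] _ /=.
    by rewrite vertex_even//=; [apply: StepOdd0; lia|lia].
  by rewrite vertex_odd//; [apply: StepOdd1; lia|lia].
case: r rm => [|[|//]] _ /=.
  by rewrite vertex_odd//=; [exact: StepEven0|lia].
by rewrite vertex_even//; [apply: StepEven1; lia|lia].
Qed.

Lemma skip_specP k r : k <= K -> r <= chord_count (Skip k) ->
  skip_spec k r (chord_start (Skip k) r) (chord_stop (Skip k) r).
Proof.
have [->|k0] := posnP k => kK; first by case: r => [|[|//]] _;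
  [exact: SkipFirst0|exact: SkipFirst1].
have [uk1 [uk2 ou]] := upward_bounds k.
rewrite /= gtn_eqF//; have [->|r0] := posnP r => rm.
  by rewrite vertex_odd; [apply: Skip0; lia|lia|lia].
have [->|r1] := eqVneq r 1.
  have [->|k1] := eqVneq k 1; first exact: SkipTurn1.
  rewrite ifT; last lia.
  rewrite /gate_in ifT; last lia.
  by rewrite /strand ifT; [apply: Skip1; lia|apply/eqP; lia].
rewrite vertex_odd; [|lia|lia].
have [r2|r2] := ltnP r (2 * k).
  rewrite ltnW// /gate_in /gate_out.
  have [h1|h1] := leqP r (upward k).
    rewrite ifT; last lia.
    have -> : 2 * r.-1 - 1 = 2 * r - 3 by lia.
    have -> : 2 * r - 2 = (2 * r - 3).+1 by lia.
    apply: SkipUp => //; try lia.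
      by rewrite /strand; case: ifP; case: ifP => /eqP + /eqP; lia.
    by rewrite /strand; case: ifP; case: ifP => /eqP + /eqP; lia.
  have [h2|h2] := leqP r.-1 (upward k).
    have -> : strand k r.-1 = k by rewrite /strand ifF//; apply/eqP; lia.
    have -> : strand k r = k by rewrite /strand ifF//; apply/eqP; lia.
    have [uk|uk] := eqVneq (upward k) k; first by apply: SkipTurnEven; lia.
    by apply: SkipTurnOdd; lia.
  have -> : 2 * (2 * k - r.-1) - 2 = (2 * (2 * k - r) - 1).+1 by lia.
  apply: (@SkipDown _ _ (2 * k - r)) => //; try lia.
    by rewrite /strand; case: ifP; case: ifP => /eqP + /eqP; lia.
  by rewrite /strand; case: ifP; case: ifP => /eqP + /eqP; lia.
have [r3|r3] := eqVneq r (2 * k).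
  rewrite r3 leqnn /gate_out ifF; last lia.
  have -> : strand k (2 * k).-1 = k by rewrite /strand ifF//; apply/eqP; lia.
  have -> : 2 * (2 * k - (2 * k).-1) - 2 = 0 by lia.
  by apply: SkipX0; lia.
rewrite ifF; last lia.
have [r4|r4] := eqVneq r (2 * k).+1; first by apply: SkipX1; lia.
by apply: SkipX2; lia.
Qed.

Definition label_linked x r y s : bool :=
  interlaced pos_lt (chord_start x r) (chord_stop x r) (chord_start y s)
    (chord_stop y s).

(* The indices of the chords in which two nonadjacent edges cross. *)
Definition crossing (x y : label) : nat * nat :=
  match x, y with
  | Spoke l, Step j => (0, (l < j) : nat)
  | Spoke l, Skip k =>
      if k == 0 then (0, (l == 2) : nat)
      else if V.+1 < l + 2 * k then (0, 0)
      else if l + 2 * k == V.+1 then (1, (upward k).+1) else (0, 2 * k + 2)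
  | Step l, Step j =>
      ([&& odd l, odd j & l != 1] : nat,
       (odd l != odd j) || (odd l && (l != 1)) : nat)
  | Step l, Skip k =>
      if k == 0 then (odd l : nat, 0) else if V < l + 2 * k then (odd l : nat,
        0)
      else if l == 1 then (0, 2 * k + 1) else (odd l : nat, 2 * k + 2)
  | Skip k, Skip j => if k == 0 then (0, 2 * j + 2) else (2 * k + 2, 0)
  | _, _ => (0, 0)
  end.

Definition label_before (x y : label) : bool :=
  match x, y with
  | Spoke l, Spoke j | Step l, Step j | Skip l, Skip j => l < j
  | Spoke _, _ | Step _, Skip _ => true
  | _, _ => false
  end.

(** * Which chords of the family are linked *)

Ltac abstract_chords :=
  rewrite /label_linked; move: (chord_start _ _) (chord_stop _ _)
    (chord_start _ _) (chord_stop _ _) => p q p' q'.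

Let spoke_spoke l r j s : 0 < l <= V -> 0 < j <= V -> l < j ->
  r <= chord_count (Spoke l) -> s <= chord_count (Spoke j) ->
  ~~ label_linked (Spoke l) r (Spoke j) s.
Proof.
move=> vl vj lj rl sj; rewrite /label_linked.
move: (spoke_specP vl rl) (spoke_specP vj sj).
clear rl sj; abstract_chords.
by chord_cases; lia.
Qed.

Let spoke_step l r j s : 0 < l <= V -> 0 < j < V ->
  r <= chord_count (Spoke l) -> s <= chord_count (Step j) ->
  label_linked (Spoke l) r (Step j) s ->
  l != j /\ l != j.+1 /\ r = 0 /\ s = (l < j).
Proof.
move=> vl vj rl sj; move: (spoke_specP vl rl) (step_specP vj sj).
clear rl sj; abstract_chords.
by chord_cases; lia.
Qed.

(** [Skip 0] goes inward from [x_3], across all deeper spokes; its second chord, back to [x_1],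
    separates [x_2] from the gates and so crosses the spoke of [x_2]. *)
Let spoke_skip0 l r k s : 0 < l <= V -> k <= K -> k = 0 ->
  r <= chord_count (Spoke l) -> s <= chord_count (Skip k) ->
  label_linked (Spoke l) r (Skip k) s ->
  l != 1 /\ l != 3 /\ r = 0 /\ s = (l == 2).
Proof.
move=> vl vk k0 rl sk; move: (spoke_specP vl rl) (skip_specP vk sk).
clear rl sk; abstract_chords.
by chord_cases; lia.
Qed.

(** The first chord goes inward from depth [V - 2 * k + 2], the last one arrives from outside at
    depth [V - 2 * k]. The spoke between these depths is met at the turn, which cuts off the corner
    where it ends. *)
Let spoke_skip l r k s : 0 < l <= V -> k <= K -> 0 < k ->
  r <= chord_count (Spoke l) -> s <= chord_count (Skip k) ->
  label_linked (Spoke l) r (Skip k) s ->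
  V.+2 < l + 2 * k /\ r = 0 /\ s = 0 \/
  l + 2 * k = V.+1 /\ r = 1 /\ s = (upward k).+1 \/
  l + 2 * k < V /\ r = 0 /\ s = 2 * k + 2.
Proof.
move=> vl vk k0 rl sk; move: (spoke_specP vl rl) (skip_specP vk sk).
have uk := upward_bounds k.
clear rl sk; abstract_chords.
by chord_cases; lia.
Qed.

Let step_step l r j s : 0 < l < V -> 0 < j < V -> l < j ->
  r <= chord_count (Step l) -> s <= chord_count (Step j) ->
  label_linked (Step l) r (Step j) s ->
  l.+1 != j /\ r = [&& odd l, odd j & l != 1] /\
  s = (odd l != odd j) || (odd l && (l != 1)).
Proof.
move=> vl vj lj rl sj; move: (step_specP vl rl) (step_specP vj sj).
clear rl sj; abstract_chords.
by chord_cases; lia.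
Qed.

Let step_skip0 l r k s : 0 < l < V -> k <= K -> k = 0 ->
  r <= chord_count (Step l) -> s <= chord_count (Skip k) ->
  label_linked (Step l) r (Skip k) s -> 3 < l /\ r = odd l /\ s = 0.
Proof.
move=> vl vk k0 rl sk; move: (step_specP vl rl) (skip_specP vk sk).
clear rl sk; abstract_chords.
by chord_cases; lia.
Qed.

(** Steps between deeper vertices are crossed by the first chord, those between shallower ones by
    the last; [Step 1] is met by the chord that straddles the offset of [x_1]. *)
Let step_skip l r k s : 0 < l < V -> k <= K -> 0 < k ->
  r <= chord_count (Step l) -> s <= chord_count (Skip k) ->
  label_linked (Step l) r (Skip k) s ->
  V.+2 < l + 2 * k /\ r = odd l /\ s = 0 \/
  l = 1 /\ r = 0 /\ s = 2 * k + 1 \/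
  l != 1 /\ l.+1 + 2 * k < V /\ r = odd l /\ s = 2 * k + 2.
Proof.
move=> vl vk k0 rl sk; move: (step_specP vl rl) (skip_specP vk sk).
have uk := upward_bounds k.
clear rl sk; abstract_chords.
by chord_cases; lia.
Qed.

Let skip0_skip j r k s : j <= K -> j = 0 -> k <= K -> 0 < k ->
  r <= chord_count (Skip j) -> s <= chord_count (Skip k) ->
  label_linked (Skip j) r (Skip k) s -> r = 0 /\ s = 2 * k + 2.
Proof.
move=> vj j0 vk k0 rj sk; move: (skip_specP vj rj) (skip_specP vk sk).
have uk := upward_bounds k.
clear rj sk; abstract_chords.
by chord_cases; lia.
Qed.

(** The last chord of [Skip j] ends at depth [V - 2 * j], between the ends of the first chord of
    [Skip k]; for [k = j + 1] it is the common vertex. In the gates the strands are nested. *)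
Let skip_skip j r k s : j <= K -> 0 < j -> k <= K -> j < k ->
  r <= chord_count (Skip j) -> s <= chord_count (Skip k) ->
  label_linked (Skip j) r (Skip k) s -> j.+1 < k /\ r = 2 * j + 2 /\ s = 0.
Proof.
move=> vj j0 vk k0 rj sk; move: (skip_specP vj rj) (skip_specP vk sk).
have uj := upward_bounds j; have uk := upward_bounds k.
clear rj sk; abstract_chords.
by chord_cases; lia.
Qed.

Let spoke_self l r s : 0 < l <= V ->
  r <= chord_count (Spoke l) -> s <= chord_count (Spoke l) ->
  ~~ label_linked (Spoke l) r (Spoke l) s.
Proof.
move=> vl rl sl; move: (spoke_specP vl rl) (spoke_specP vl sl).
clear rl sl; abstract_chords.
by chord_cases; lia.
Qed.

Let step_self l r s : 0 < l < V ->
  r <= chord_count (Step l) -> s <= chord_count (Step l) ->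
  ~~ label_linked (Step l) r (Step l) s.
Proof.
move=> vl rl sl; move: (step_specP vl rl) (step_specP vl sl).
clear rl sl; abstract_chords.
by chord_cases; lia.
Qed.

Let skip_self k r s : k <= K ->
  r <= chord_count (Skip k) -> s <= chord_count (Skip k) ->
  ~~ label_linked (Skip k) r (Skip k) s.
Proof.
move=> vk rk sk; move: (skip_specP vk rk) (skip_specP vk sk).
have uk := upward_bounds k.
clear rk sk; abstract_chords.
by chord_cases; lia.
Qed.

Let spoke_step_cross l r j s : 0 < l <= V -> 0 < j < V ->
  r <= chord_count (Spoke l) -> s <= chord_count (Step j) ->
  l != j /\ l != j.+1 /\ r = 0 /\ s = (l < j) ->
  label_linked (Spoke l) r (Step j) s.
Proof.
move=> vl vj rl sj cond; move: (spoke_specP vl rl) (step_specP vj sj).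
clear rl sj; abstract_chords.
by chord_cases; lia.
Qed.

Let spoke_skip0_cross l r k s : 0 < l <= V -> k <= K -> k = 0 ->
  r <= chord_count (Spoke l) -> s <= chord_count (Skip k) ->
  l != 1 /\ l != 3 /\ r = 0 /\ s = (l == 2) ->
  label_linked (Spoke l) r (Skip k) s.
Proof.
move=> vl vk k0 rl sk cond; move: (spoke_specP vl rl) (skip_specP vk sk).
clear rl sk; abstract_chords.
by chord_cases; lia.
Qed.

Let spoke_skip_cross l r k s : 0 < l <= V -> k <= K -> 0 < k ->
  r <= chord_count (Spoke l) -> s <= chord_count (Skip k) ->
  V.+2 < l + 2 * k /\ r = 0 /\ s = 0 \/
  l + 2 * k = V.+1 /\ r = 1 /\ s = (upward k).+1 \/
  l + 2 * k < V /\ r = 0 /\ s = 2 * k + 2 ->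
  label_linked (Spoke l) r (Skip k) s.
Proof.
move=> vl vk k0 rl sk; move: (spoke_specP vl rl) (skip_specP vk sk).
have uk := upward_bounds k.
clear rl sk; abstract_chords => + + [cond|[cond|cond]];
  by chord_cases; lia.
Qed.

Let step_step_cross l r j s : 0 < l < V -> 0 < j < V -> l < j ->
  r <= chord_count (Step l) -> s <= chord_count (Step j) ->
  l.+1 != j /\ r = [&& odd l, odd j & l != 1] /\
  s = (odd l != odd j) || (odd l && (l != 1)) ->
  label_linked (Step l) r (Step j) s.
Proof.
move=> vl vj lj rl sj cond; move: (step_specP vl rl) (step_specP vj sj).
clear rl sj; abstract_chords.
by chord_cases; lia.
Qed.

Let step_skip0_cross l r k s : 0 < l < V -> k <= K -> k = 0 ->
  r <= chord_count (Step l) -> s <= chord_count (Skip k) ->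
  3 < l /\ r = odd l /\ s = 0 ->
  label_linked (Step l) r (Skip k) s.
Proof.
move=> vl vk k0 rl sk cond; move: (step_specP vl rl) (skip_specP vk sk).
clear rl sk; abstract_chords.
by chord_cases; lia.
Qed.

Let step_skip_cross l r k s : 0 < l < V -> k <= K -> 0 < k ->
  r <= chord_count (Step l) -> s <= chord_count (Skip k) ->
  V.+2 < l + 2 * k /\ r = odd l /\ s = 0 \/
  l = 1 /\ r = 0 /\ s = 2 * k + 1 \/
  l != 1 /\ l.+1 + 2 * k < V /\ r = odd l /\ s = 2 * k + 2 ->
  label_linked (Step l) r (Skip k) s.
Proof.
move=> vl vk k0 rl sk; move: (step_specP vl rl) (skip_specP vk sk).
have uk := upward_bounds k.
clear rl sk; abstract_chords => + + [cond|[cond|cond]];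
  by chord_cases; lia.
Qed.

Let skip0_skip_cross j r k s : j <= K -> j = 0 -> k <= K -> 0 < k ->
  r <= chord_count (Skip j) -> s <= chord_count (Skip k) ->
  r = 0 /\ s = 2 * k + 2 ->
  label_linked (Skip j) r (Skip k) s.
Proof.
move=> vj j0 vk k0 rj sk cond; move: (skip_specP vj rj) (skip_specP vk sk).
have uk := upward_bounds k.
clear rj sk; abstract_chords.
by chord_cases; lia.
Qed.

Let skip_skip_cross j r k s : j <= K -> 0 < j -> k <= K -> j < k ->
  r <= chord_count (Skip j) -> s <= chord_count (Skip k) ->
  j.+1 < k /\ r = 2 * j + 2 /\ s = 0 ->
  label_linked (Skip j) r (Skip k) s.
Proof.
move=> vj j0 vk k0 rj sk cond; move: (skip_specP vj rj) (skip_specP vk sk).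
have uj := upward_bounds j; have uk := upward_bounds k.
clear rj sk; abstract_chords.
by chord_cases; lia.
Qed.

(** * Gluing of consecutive chords, and distinctness of the boundary points visited *)

Let spoke_count l : l = 2 /\ chord_count (Spoke l) = K \/
  l <> 2 /\ chord_count (Spoke l) = 1.
Proof. by rewrite /=; case: eqP; [left|right]. Qed.

Let step_count l : l = 1 /\ chord_count (Step l) = 0 \/
  l <> 1 /\ chord_count (Step l) = 1.
Proof. by rewrite /=; case: eqP; [left|right]. Qed.

Let skip_count k : k = 0 /\ chord_count (Skip k) = 1 \/
  0 < k /\ chord_count (Skip k) = 2 * k + 2.
Proof. by rewrite /=; case: posnP; [left|right]. Qed.

(** The successor is a variable [r'] with an equation, because the case analysis on [spoke_spec]
    needs a variable as index. *)
Let spoke_glue l r r' : 0 < l <= V -> r < chord_count (Spoke l) -> r' = r.+1 ->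
  pos_class (chord_start (Spoke l) r') = pos_class (chord_stop (Spoke l) r).
Proof.
move=> vl rl e; have rl' : r' <= chord_count (Spoke l) by rewrite e.
move: (spoke_specP vl (ltnW rl)) (spoke_specP vl rl').
have c := spoke_count l; move: c rl; clear rl'; abstract_chords.
move: (chord_count _) => m c rl.
by class_cases; lia.
Qed.

Let step_glue l r r' : 0 < l < V -> r < chord_count (Step l) -> r' = r.+1 ->
  pos_class (chord_start (Step l) r') = pos_class (chord_stop (Step l) r).
Proof.
move=> vl rl e; have rl' : r' <= chord_count (Step l) by rewrite e.
move: (step_specP vl (ltnW rl)) (step_specP vl rl').
have c := step_count l; move: c rl; clear rl'; abstract_chords.
move: (chord_count _) => m c rl.
by class_cases; lia.
Qed.

Let skip_glue l r r' : l <= K -> r < chord_count (Skip l) -> r' = r.+1 ->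
  pos_class (chord_start (Skip l) r') = pos_class (chord_stop (Skip l) r).
Proof.
move=> vl rl e; have rl' : r' <= chord_count (Skip l) by rewrite e.
move: (skip_specP vl (ltnW rl)) (skip_specP vl rl').
have c := skip_count l; have uk := upward_bounds l; move: c rl; clear rl';
  abstract_chords.
move: (chord_count _) => m c rl.
by class_cases; lia.
Qed.

Let spoke_spoke_inner l r j s : 0 < l <= V -> 0 < j <= V ->
  r < chord_count (Spoke l) -> s < chord_count (Spoke j) ->
  pos_class (chord_stop (Spoke l) r) = pos_class (chord_stop (Spoke j) s) -> l
    = j /\ r = s.
Proof.
move=> vl vj rl sj.
move: (spoke_specP vl (ltnW rl)) (spoke_specP vj (ltnW sj)).
have c := spoke_count l; have d := spoke_count j; move: c d rl sj.
abstract_chords; move: (chord_count _) (chord_count _) => m n c d rl sj.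
by class_cases; lia.
Qed.

Let spoke_step_inner l r j s : 0 < l <= V -> 0 < j < V ->
  r < chord_count (Spoke l) -> s < chord_count (Step j) ->
  pos_class (chord_stop (Spoke l) r) = pos_class (chord_stop (Step j) s) ->
    False.
Proof.
move=> vl vj rl sj.
move: (spoke_specP vl (ltnW rl)) (step_specP vj (ltnW sj)).
have c := spoke_count l; have d := step_count j; move: c d rl sj.
abstract_chords; move: (chord_count _) (chord_count _) => m n c d rl sj.
by class_cases; lia.
Qed.

Let spoke_skip_inner l r j s : 0 < l <= V -> j <= K ->
  r < chord_count (Spoke l) -> s < chord_count (Skip j) ->
  pos_class (chord_stop (Spoke l) r) = pos_class (chord_stop (Skip j) s) ->
    False.
Proof.
move=> vl vj rl sj.
move: (spoke_specP vl (ltnW rl)) (skip_specP vj (ltnW sj)).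
have c := spoke_count l; have d := skip_count j; have uj := upward_bounds j;
  move: c d rl sj.
abstract_chords; move: (chord_count _) (chord_count _) => m n c d rl sj.
by class_cases; lia.
Qed.

Let step_step_inner l r j s : 0 < l < V -> 0 < j < V ->
  r < chord_count (Step l) -> s < chord_count (Step j) ->
  pos_class (chord_stop (Step l) r) = pos_class (chord_stop (Step j) s) -> l =
    j /\ r = s.
Proof.
move=> vl vj rl sj.
move: (step_specP vl (ltnW rl)) (step_specP vj (ltnW sj)).
have c := step_count l; have d := step_count j; move: c d rl sj.
abstract_chords; move: (chord_count _) (chord_count _) => m n c d rl sj.
by class_cases; lia.
Qed.

Let step_skip_inner l r j s : 0 < l < V -> j <= K ->
  r < chord_count (Step l) -> s < chord_count (Skip j) ->
  pos_class (chord_stop (Step l) r) = pos_class (chord_stop (Skip j) s) ->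
    False.
Proof.
move=> vl vj rl sj.
move: (step_specP vl (ltnW rl)) (skip_specP vj (ltnW sj)).
have c := step_count l; have d := skip_count j; have uj := upward_bounds j;
  move: c d rl sj.
abstract_chords; move: (chord_count _) (chord_count _) => m n c d rl sj.
by class_cases; lia.
Qed.

Let skip_skip_inner l r j s : l <= K -> j <= K ->
  r < chord_count (Skip l) -> s < chord_count (Skip j) ->
  pos_class (chord_stop (Skip l) r) = pos_class (chord_stop (Skip j) s) -> l =
    j /\ r = s.
Proof.
move=> vl vj rl sj.
move: (skip_specP vl (ltnW rl)) (skip_specP vj (ltnW sj)).
have c := skip_count l; have d := skip_count j; have uk := upward_bounds l;
  have uj := upward_bounds j; move: c d rl sj.
abstract_chords; move: (chord_count _) (chord_count _) => m n c d rl sj.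
by class_cases; lia.
Qed.

Variant vertex_spec (v : nat) : nat * nat -> Prop :=
| VertexApex of v = 0 : vertex_spec v (0, 0)
| VertexFirst of v = 1 : vertex_spec v (2 * K + 3, U)
| VertexOdd of odd v & 1 < v : vertex_spec v (2 * K + 1, v)
| VertexEven t of ~~ odd v & 0 < v & t + v = T : vertex_spec v (2 * K + 2, t).

Lemma vertex_specP v : v <= V -> vertex_spec v (vertex_pos v).
Proof.
move=> vV; have [->|v0] := eqVneq v 0; first exact: VertexApex.
have [->|v1] := eqVneq v 1; first exact: VertexFirst.
have [ov|ov] := boolP (odd v).
  by rewrite vertex_odd//; [apply: VertexOdd; lia|lia].
by rewrite vertex_even//; [apply: VertexEven; lia|lia].
Qed.

Let vertex_class_inj v v' : v <= V -> v' <= V ->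
  pos_class (vertex_pos v) = pos_class (vertex_pos v') -> v = v'.
Proof.
move=> vV vV'; move: (vertex_specP vV) (vertex_specP vV').
by move: (vertex_pos _) (vertex_pos _) => p q; class_cases; lia.
Qed.

Let inner_vertex x r v : valid_label x -> r < chord_count x -> v <= V ->
  pos_class (chord_stop x r) <> pos_class (vertex_pos v).
Proof.
case: x => [l|l|k] vx rx vV; move: (vertex_specP vV).
- have vl : 0 < l <= V := vx; move: (spoke_specP vx (ltnW rx));
    have c := spoke_count l; move: c rx.
  move: (chord_start _ _) (chord_stop _ _) (chord_count _) (vertex_pos _).
  by move=> p q n z c rn; class_cases; lia.
- have vl : 0 < l < V := vx; move: (step_specP vx (ltnW rx));
    have c := step_count l; move: c rx.
  move: (chord_start _ _) (chord_stop _ _) (chord_count _) (vertex_pos _).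
  by move=> p q n z c rn; class_cases; lia.
- have vk : k <= K := vx; move: (skip_specP vx (ltnW rx));
    have c := skip_count k; move: c rx.
  have uk := upward_bounds k; move: (chord_start _ _) (chord_stop _ _)
    (chord_count _) (vertex_pos _).
  by move=> p q n z c rn; class_cases; lia.
Qed.

Let label_valid x r : valid_label x -> r <= chord_count x ->
  valid_pos (K + 2) T (chord_start x r) && valid_pos (K + 2) T (chord_stop x r).
Proof.
case: x => [l|l|k] vx rx.
- have vl : 0 < l <= V := vx; move: (spoke_specP vx rx) => [];
    rewrite /valid_pos /=; lia.
- have vl : 0 < l < V := vx; move: (step_specP vx rx) => [];
    rewrite /valid_pos /=; lia.
- have vk : k <= K := vx; move: (skip_specP vx rx); have uk := upward_bounds k.
  by case=> *; rewrite /valid_pos /=; lia.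
Qed.

Let label_glue x r : valid_label x -> r < chord_count x ->
  pos_class (chord_start x r.+1) = pos_class (chord_stop x r).
Proof.
case: x => [l|l|k] vx rx.
- exact: spoke_glue vx rx _.
- exact: step_glue vx rx _.
- exact: skip_glue vx rx _.
Qed.

Let label_begin x :
  pos_class (chord_start x 0) = pos_class (vertex_pos (label_ends x).1).
Proof. by case: x => [l|l|k] //=; case: ifP. Qed.

Let label_end x : valid_label x ->
  pos_class (chord_stop x (chord_count x)) =
  pos_class (vertex_pos (label_ends x).2).
Proof.
case: x => [l|l|k] vx /=.
- have [_|l2] := eqVneq l 2; first by rewrite eqxx.
  by case: ifP.
- have [->|l1] := eqVneq l 1; last by [].
  by rewrite pos_class_eq /=; lia.
- have [//|k0] := eqVneq k 0.
  by rewrite ifF ?ifF//; lia.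
Qed.

Let label_linkedP x y r s : valid_label x -> valid_label y ->
  label_before x y -> r <= chord_count x -> s <= chord_count y ->
  label_linked x r y s ->
  ~~ share (label_ends x) (label_ends y) /\ (r, s) = crossing x y.
Proof.
case: x y => [l|l|j] [l'|l'|k] //= vx vy b rx sy lk.
- by have := spoke_spoke vx vy b rx sy; rewrite lk.
- have [h1 [h2 [-> ->]]] := spoke_step vx vy rx sy lk.
  by split=> //; rewrite /share /=; lia.
- have [k0|k0] := posnP k.
    have [h1 [h2 [-> ->]]] := spoke_skip0 vx vy k0 rx sy lk.
    by rewrite /share /=; split=> //; lia.
  have := spoke_skip vx vy k0 rx sy lk; rewrite /share /=.
  case=> [[h [-> ->]]|[[h [-> ->]]|[h [-> ->]]]].
  + by rewrite ifT; [split=> //; lia|lia].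
  + by rewrite ifF ?ifT; [split=> //; lia|lia|lia].
  + by rewrite ifF ?ifF; [split=> //; lia|lia|lia].
- have [h [-> ->]] := step_step vx vy b rx sy lk.
  by split=> //; rewrite /share /=; lia.
- have [k0|k0] := posnP k.
    have [h [-> ->]] := step_skip0 vx vy k0 rx sy lk.
    by rewrite /share /=; split=> //; lia.
  have := step_skip vx vy k0 rx sy lk; rewrite /share /=.
  case=> [[h [-> ->]]|[[h [-> ->]]|[h [h' [-> ->]]]]].
  + by rewrite ifT; [split=> //; lia|lia].
  + by rewrite h ifF ?eqxx; [split=> //; lia|lia].
  + by rewrite ifF ?ifF; [split=> //; lia|lia|lia].
- have k0 : 0 < k by lia.
  have [j0|j0] := posnP j.
    have [-> ->] := skip0_skip vx j0 vy k0 rx sy lk.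
    by rewrite gtn_eqF// /share /=; split=> //; lia.
  have [h [-> ->]] := skip_skip vx j0 vy b rx sy lk.
  by rewrite gtn_eqF// /share /=; split=> //; lia.
Qed.

Let label_crossP x y : valid_label x -> valid_label y -> label_before x y ->
  ~~ share (label_ends x) (label_ends y) ->
  [/\ (crossing x y).1 <= chord_count x, (crossing x y).2 <= chord_count y
    & label_linked x (crossing x y).1 y (crossing x y).2].
Proof.
case: x y => [l|l|j] [l'|l'|k] //= vx vy b; rewrite /share /=.
- by rewrite !orbT.
- move=> sh; have c := step_count l'.
  have rx : 0 <= chord_count (Spoke l) by [].
  have sy : (l < l') <= chord_count (Step l') by lia.
  by split=> //; apply: spoke_step_cross => //; lia.
- have c := spoke_count l; have d := skip_count k.
  have uk := upward_bounds k.
  have [k0|k0] := posnP k=> /= sh.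
    have sy : (l == 2) <= chord_count (Skip k) by lia.
    by split=> //; try lia; apply: spoke_skip0_cross => //; lia.
  case: ifP => [h|h1]; last case: ifP => [h|h2]; move=> /=.
  + by split=> //; apply: spoke_skip_cross => //; lia.
  + have rx : 1 <= chord_count (Spoke l) by lia.
    have sy : (upward k).+1 <= chord_count (Skip k) by lia.
    by split=> //; try lia; apply: spoke_skip_cross => //; lia.
  + have sy : 2 * k + 2 <= chord_count (Skip k) by lia.
    by split=> //; try lia; apply: spoke_skip_cross => //; lia.
- move=> sh; have c := step_count l; have d := step_count l'.
  have rx : [&& odd l, odd l' & l != 1] <= chord_count (Step l) by lia.
  have sy : (odd l != odd l') || (odd l && (l != 1)) <= chord_count (Step l').
    by lia.
  by split=> //; apply: step_step_cross => //; lia.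
- have c := step_count l; have d := skip_count k.
  have [k0|k0] := posnP k=> /= sh.
    have rx : odd l <= chord_count (Step l) by lia.
    by split=> //; apply: step_skip0_cross => //; lia.
  case: ifP => [h|h1]; last case: ifP => [/eqP h|h2]; move=> /=.
  + have rx : odd l <= chord_count (Step l) by lia.
    by split=> //; apply: step_skip_cross => //; lia.
  + have sy : 2 * k + 1 <= chord_count (Skip k) by lia.
    by split=> //; try lia; apply: step_skip_cross => //; lia.
  + have rx : odd l <= chord_count (Step l) by lia.
    have sy : 2 * k + 2 <= chord_count (Skip k) by lia.
    by split=> //; try lia; apply: step_skip_cross => //; lia.
- have c := skip_count j; have d := skip_count k.
  have k0 : 0 < k by lia.
  rewrite (gtn_eqF k0); have [j0|j0] := posnP j => /= sh.
    have sy : 2 * k + 2 <= chord_count (Skip k) by lia.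
    by split=> //; try lia; apply: skip0_skip_cross => //; lia.
  have rx : 2 * j + 2 <= chord_count (Skip j) by lia.
  by split=> //; try lia; apply: skip_skip_cross => //; lia.
Qed.

Let label_inner x y r s : valid_label x -> valid_label y ->
  r < chord_count x -> s < chord_count y -> x = y \/ label_before x y ->
  pos_class (chord_stop x r) = pos_class (chord_stop y s) -> x = y /\ r = s.
Proof.
case: x y => [l|l|j] [l'|l'|k] vx vy rx sy [] // _ e.
all: by [have [-> ->] := spoke_spoke_inner vx vy rx sy e
  |have := spoke_step_inner vx vy rx sy e|have := spoke_skip_inner vx vy rx sy e
  |have [-> ->] := step_step_inner vx vy rx sy e
  |have := step_skip_inner vx vy rx sy e
  |have [-> ->] := skip_skip_inner vx vy rx sy e].
Qed.

Let label_total x y : x <> y -> label_before x y || label_before y x.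
Proof.
case: x y => [l|l|j] [l'|l'|k] //= xy; rewrite -neq_ltn;
  by apply/eqP => e; apply: xy; rewrite e.
Qed.

(** * The family as a numbered system *)

Let L : finType := ('I_V + 'I_V.-1 + 'I_K.+1)%type.

Let label_of (x : L) : label :=
  match x with
  | inl (inl i) => Spoke i.+1
  | inl (inr i) => Step i.+1
  | inr k => Skip k
  end.

Let label_ofP x : valid_label (label_of x).
Proof.
case: x => [[i|i]|k] /=; [have := ltn_ord i|have := ltn_ord i|have := ltn_ord
  k];
  by move: (nat_of_ord _) => n; lia.
Qed.

Let label_of_inj : injective label_of.
Proof.
move=> [[i|i]|k] [[i'|i']|k'] //= [e]; congr inl + congr inr;
  by [congr inl; apply: val_inj|congr inr; apply: val_inj|apply: val_inj].
Qed.

Lemma family_system : numbered_system (K + 2) T V (label_ends \o label_of)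
  vertex_pos (chord_count \o label_of) (chord_start \o label_of)
  (chord_stop \o label_of) (fun x y => label_before (label_of x) (label_of y))
  (fun x y => crossing (label_of x) (label_of y)).
Proof.
split.
- move=> x /=; case: (label_of x) (label_ofP x) => [l|l|k] /=; try lia.
  by case: ifP => /=; lia.
- move=> x y /= e; apply: label_of_inj; move: (label_ofP x) (label_ofP y) e.
  case: (label_of x) (label_of y) => [l|l|j] [l'|l'|k] //= vx vy;
    do ?[case: ifP => ?]; try case; move=> *; try (exfalso; lia);
    first [by congr Spoke; lia|by congr Step; lia|by congr Skip; lia].
- move=> v /andP[v0 vV]; have vV' : v.-1 < V by lia.
  by exists (inl (inl (Ordinal vV'))) => /=; rewrite prednK.
- move=> v vV; case: (vertex_specP vV) => *; rewrite /valid_pos /=; lia.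
- exact: vertex_class_inj.
- by move=> x r; apply: label_valid.
- by move=> x r; apply: label_glue.
- by move=> x; apply: label_begin.
- by move=> x; apply: label_end.
- by move=> x r v rx vV; apply/eqP/inner_vertex.
- move=> x r y s /= rx sy b e.
  suff [/label_of_inj -> ->] : label_of x = label_of y /\ r = s by [].
  apply: label_inner (label_ofP x) (label_ofP y) rx sy _ e.
  by case/orP: b => [/eqP ->|]; [left|right].
- move=> x y xy; apply: label_total => /label_of_inj e.
  by rewrite e eqxx in xy.
- move=> x r s /=; rewrite /linked /=.
  case: (label_of x) (label_ofP x) => [l|l|j] vx rx sx.
  + exact: spoke_self.
  + exact: step_self.
  + exact: skip_self.
- by move=> x y r s b rx sy lk; apply: label_linkedP.
- by move=> x y b; apply: label_crossP.
Qed.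

Lemma family_thrackle (R : realType) : exists e : rel 'I_w.*2.+2,
  [/\ simple_graph e, connected_graph e,
    #|edges e| = w.*2.+1 + w.*2 + K.+1
    & can_be_thrackled R e (nonorientable_surface R (K + 2))].
Proof.
have g0 : 0 < K + 2 by lia.
have T0 : 0 < T by rewrite /T; lia.
have [e [e1 e2 e3 e4]] := numbered_system_thrackle family_system R g0 T0.
by exists e; split=> //; rewrite e3 !card_sum !card_ord.
Qed.

End Family.

Theorem theorem1p4 (R : realType) (g : nat) (N : int) (hg : (1 <= g)%N) :
  exists (V : finType) (e : rel V),
    [/\ simple_graph e,
        connected_graph e,
        N <= #|V|%:Z,
        #|edges e|%:Z = 2 * #|V|%:Z + g%:Z - 4 &
        can_be_thrackled R e (nonorientable_surface R g)].
Proof.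
have NN : N <= `|N|%N%:Z by exact: lez_abs.
have [g1|g1] := leqP g 1.
  have -> : g = 1%N by lia.
  have [e [e1 e2 e3 e4]] := fan_thrackle `|N|.+1 R.
  by exists 'I_`|N|.+2, e; split=> //; rewrite ?e3 card_ord; lia.
have gE : g = (g - 2 + 2)%N by lia.
(* The choices are [K = g - 2] and [w = |N| + g]: [w] is at least [K + 2], and there are [2 * w + 2]
   vertices. *)
have w0 : (g - 2 + 2 <= `|N| + g)%N by lia.
have [e [e1 e2 e3 e4]] := family_thrackle w0 R; rewrite -gE in e4.
exists 'I_(`|N| + g).*2.+2, e.
by split=> //; rewrite ?e3 card_ord; lia.
Qed.
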